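(* Let $\nu\in(0,\nu_0]$. For $\ell\in J_2=(C_1\nu^\beta,C_2]$, the flatness $F(\ell)=S_4(\ell)/S_2^2(\ell)$ satisfies $$F(\ell)\sim\ell^{-1}.$$
   Context: Setting. $S^1=\mathbb{R}/\mathbb{Z}$; $\alpha\in(1,2)$ is a fixed constant, $\beta=1/(\alpha-1)$, $\nu\in(0,1]$. $\Lambda=\sqrt{-\Delta}$, so $\Lambda^\alpha$ is the Fourier multiplier by $(2\pi|k|)^\alpha$, $k\in\mathbb{Z}$. The function $f:\mathbb{R}\to\mathbb{R}$ is $C^\infty$, satisfies $f''\geq\sigma>0$ on $\mathbb{R}$, and for each integer $m\geq0$ there are $h(m)\geq0$, $C_m>0$ with $|f^{(m)}(x)|\leq C_m(1+|x|)^{h(m)}$ for all $x\in\mathbb{R}$, where $1\leq h(1)<2$. The initial condition $u_0:S^1\to\mathbb{R}$ is $C^\infty$, has zero mean and is not identically zero; $u=u(t,x)$ is the (global, smooth, zero space average) solution of $$u_t+(f(u))_x+\nu\Lambda^\alpha u=0,\quad t\geq0,\ x\in S^1,\qquad u(0)=u_0.$$ Norms (for zero-mean functions $v$ on $S^1$). $|v|_p$ is the $L_p(S^1)$ norm; $|v|_{m,p}=|d^mv/dx^m|_p$ for integer $m\geq0$; $\|v\|_s=(2\pi)^s\big(\sum_{k\in\mathbb{Z}}|k|^{2s}|\hat v^k|^2\big)^{1/2}$ for real $s\geq0$. $D=\max(|u_0|_1^{-1},|u_0|_{1,\infty})>1$. Constants. $X\lesssim Y$ means $X\leq CY$ with $C>0$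 depending only on $f$, $D$ and the fixed constant $\alpha$ (in particular independent of $\nu$ and $\ell$); $X\sim Y$ means $X\lesssim Y$ and $Y\lesssim X$. Time average. Fix a constant $\tilde C>0$ depending only on $f,D,\alpha$ such that $\|u(t)\|_{\alpha/2}^2\leq\tilde C\nu^{-1}$ for all $t\geq0$ (such a constant exists). Put $T_1=\frac14D^{-2}\tilde C^{-1}$, $T_2=\max\big(\frac32T_1,\,2D\sigma^{-1}\big)$, and $\lbrace A(t)\rbrace=\frac1{T_2-T_1}\int_{T_1}^{T_2}A(s)\,ds$. Structure functions. $S_p(\ell)=\Big\lbrace\int_{S^1}|u(t,x+\ell)-u(t,x)|^p\,dx\Big\rbrace$ for $p\geq0$, $0<\ell\leq1$; $S_2^2(\ell)=(S_2(\ell))^2$. Choice of $C_1,C_2,\nu_0$. For $K>1$ let $L_K$ be the set of $t\in[T_1,T_2]$ such that $K^{-1}\leq|u(t)|_\infty\leq\max_x u_x(t,x)\leq K$, $K^{-1}\nu^{-\beta}\leq|u(t)|_{1,\infty}\leq K\nu^{-\beta}$ and $|u(t)|_{2,\infty}\leq K\nu^{-2\beta}$. There exist constants $C>0$ and $K_1>1$ depending only on $f,D,\alpha$ such that for every $K\geq K_1$ the Lebesgue measure of $L_K$ is at least $C$. Fix such $C$, $K_1$, set $K=K_1$ and $$\nu_0=\Big(\tfrac16K^{-2}\Big)^{1/\beta},\qquad C_1=\tfrac14K^{-2},\qquad C_2=\tfrac1{20}K^{-4}.$$ *)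

(* Defs.v *)
From mathcomp Require Import all_boot all_order all_algebra.
From mathcomp Require Import all_classical all_reals all_analysis.
From mathcomp Require Import complex.

Set Implicit Arguments.
Unset Strict Implicit.
Unset Printing Implicit Defensive.

Import Order.TTheory GRing.Theory Num.Theory.
Import numFieldNormedType.Exports.

Local Open Scope ring_scope.
Local Open Scope classical_set_scope.

(* Functions on S^1 = R/Z are 1-periodic functions on R; integrals and norms
   on S^1 are taken over the fundamental domain [0, 1]. *)

Section Circle.
Context {R : realType}.
Implicit Types (v : R -> R) (k : int) (p : \bar R) (s x : R).

Definition smooth v : Prop := forall n x, derivable (v^`(n)) x 1.

(* \hat v^k, i.e. the integral of v(x) exp(-2 pi i k x) over S^1 *)
Definition fourier_coef v k : R[i] :=
  Complex
    (\int[lebesgue_measure]_(x in `[0%R, 1%R]) (v x * cos (2 * pi * k%:~R * x)))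
    (- \int[lebesgue_measure]_(x in `[0%R, 1%R]) (v x * sin (2 * pi * k%:~R * x))).

Definition fourier_mode k x : R[i] :=
  Complex (cos (2 * pi * k%:~R * x)) (sin (2 * pi * k%:~R * x)).

(* Lambda^s, as the limit of the symmetric partial sums over -N <= k <= N of
   (2 pi |k|)^s \hat v^k exp(2 pi i k x).  For real v the terms k and -k are
   complex conjugate, so that taking real parts does not change these sums. *)
Definition Lambda s v x : R :=
  limn (fun N : nat => \sum_(i < N.*2.+1)
    let k := (i : nat)%:Z - N%:Z in
    (2 * pi * `|k|%:~R) `^ s *
      complex.Re (fourier_coef v k * fourier_mode k x)).

(* |v|_p; the Lnorm is finite, hence not altered by fine, when v is continuous
   and p is at least 1. *)
Definition lpnorm p v : R :=
  fine ('N[lebesgue_measure]_p[(EFin \o v) \_ `[0%R, 1%R]]).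

(* |v|_{m,p} *)
Definition wnorm (m : nat) p v : R := lpnorm p (v^`(m)).

(* ||v||_s *)
Definition hsnorm s v : \bar R :=
  (((2 * pi) `^ s)%:E *
   (\esum_(k in [set: int])
      (`|k|%:~R `^ (2 * s) * ComplexField.Normc.normc (fourier_coef v k) ^+ 2)%:E) `^ 2^-1)%E.

End Circle.

Section Equation.
Context {R : realType}.
Implicit Types (f v : R -> R) (u : R -> R -> R).

(* Only the values u t x with 0 <= t are meaningful. *)

(* u_t, one-sided at t = 0 *)
Definition dt u (t x : R) : R :=
  lim ((fun s => (u s x - u t x) / (s - t)) @ within [set s | 0 <= s] t^').

(* u is C^oo on [0, +oo[ x R: U i j is the (i, j)-th partial derivative of u,
   with one-sided time derivatives at t = 0. *)
Definition spacetime_smooth u : Prop :=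
  exists U : nat -> nat -> R -> R -> R,
    [/\ forall t x : R, 0 <= t -> U 0%N 0%N t x = u t x,
        forall i j (t x : R), 0 <= t -> is_derive x (1 : R) (U i j t) (U i j.+1 t x),
        forall i j (t x : R), 0 <= t ->
          (fun s => (U i j s x - U i j t x) / (s - t))
            @ within [set s | 0 <= s] t^' --> U i.+1 j t x
      & forall i j, {within [set q : R * R | 0 <= q.1],
                       continuous (fun q : R * R => U i j q.1 q.2)}].

Definition admissible_flux f (sigma : R) : Prop :=
  [/\ smooth f,
      0 < sigma,
      forall x, sigma <= f^`(2) x
    & exists (h C : nat -> R),
        [/\ forall m, 0 <= h m,
            forall m, 0 < C m,
            1 <= h 1%N < 2
          & forall m x, `|f^`(m) x| <= C m * (1 + `|x|) `^ h m]].

Definition D_of (u0 : R -> R) : R := Num.max (lpnorm 1 u0)^-1 (wnorm 1 +oo u0).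

Definition initial_condition (D : R) (u0 : R -> R) : Prop :=
  [/\ smooth u0,
      periodic u0 1,
      \int[lebesgue_measure]_(x in `[0%R, 1%R]) u0 x = 0,
      exists x, u0 x != 0
    & D_of u0 = D].

Definition solution (alpha nu : R) f (u0 : R -> R) u : Prop :=
  [/\ spacetime_smooth u,
      forall t : R, 0 <= t -> periodic (u t) 1,
      forall t : R, 0 <= t -> \int[lebesgue_measure]_(x in `[0%R, 1%R]) u t x = 0,
      forall x, u 0 x = u0 x
    & forall t x : R, 0 <= t ->
        dt u t x + (f \o u t)^`()%classic x + nu * Lambda alpha (u t) x = 0].

End Equation.

Section Turbulence.
Context {R : realType}.
Implicit Types (u : R -> R -> R) (alpha nu sigma D Ct K l p : R).

Definition beta alpha : R := (alpha - 1)^-1.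

(* Ct stands for the constant \tilde C. *)
Definition T1 D Ct : R := 4^-1 * D ^- 2 * Ct^-1.

Definition T2 sigma D Ct : R := Num.max (3 / 2 * T1 D Ct) (2 * D / sigma).

Definition time_average sigma D Ct (A : R -> R) : R :=
  (T2 sigma D Ct - T1 D Ct)^-1 *
    \int[lebesgue_measure]_(s in `[T1 D Ct, T2 sigma D Ct]) A s.

(* S_p(l) *)
Definition structure_function sigma D Ct u p l : R :=
  time_average sigma D Ct (fun t =>
    \int[lebesgue_measure]_(x in `[0%R, 1%R]) (`|u t (x + l) - u t x| `^ p)).

Definition flatness sigma D Ct u l : R :=
  structure_function sigma D Ct u 4 l / structure_function sigma D Ct u 2 l ^+ 2.

Definition L_set alpha sigma D Ct nu u K : set R :=
  [set t | [/\ T1 D Ct <= t <= T2 sigma D Ct,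
      [/\ K^-1 <= lpnorm +oo (u t),
          lpnorm +oo (u t) <= sup (range (u t)^`())
        & sup (range (u t)^`()) <= K],
      K^-1 * nu `^ (- beta alpha) <= wnorm 1 +oo (u t)
        <= K * nu `^ (- beta alpha)
    & wnorm 2 +oo (u t) <= K * nu `^ (- 2 * beta alpha)]].

Definition nu0 alpha K : R := (6^-1 * K ^- 2) `^ (beta alpha)^-1.

Definition C1 K : R := 4^-1 * K ^- 2.

Definition C2 K : R := 20^-1 * K ^- 4.

End Turbulence.

(* Main.v *)
Require Import Defs.
From mathcomp Require Import all_boot all_order all_algebra.
From mathcomp Require Import all_classical all_reals all_analysis.
From mathcomp Require Import measurable_realfun ess_sup_inf.
From mathcomp Require Import ring lra.

Set Implicit Arguments.
Unset Strict Implicit.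
Unset Printing Implicit Defensive.

Import Order.TTheory GRing.Theory Num.Theory.
Import numFieldNormedType.Exports.

Local Open Scope ring_scope.
Local Open Scope classical_set_scope.

(** The flatness is S_4(l) / S_2(l)^2, so everything follows once S_2(l) and
    S_4(l) are both squeezed between two constant multiples of l.

    Upper bounds. At every time t >= 0 the solution satisfies the one-sided
    Lipschitz estimate u(t, y) - u(t, x) <= D (y - x) for x <= y
    ([one_sided_lipschitz]).  Since an increment has zero mean over the circle,
    the integral of its absolute value is at most 2 D l, and since |u| <= D the
    higher moments only cost powers of 2 D ([mean_incr_le]).

    Lower bounds. At a time t in L_K the profile has a cliff: somewhere u_x is
    below - nu^(-beta) / K, it stays comparable to that value over a length
    of order nu^beta because u_xx is bounded by K nu^(-2 beta), and u_x <= K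
    elsewhere.  Hence every interval [x, x + l] which contains the cliff carries
    a drop of order one ([cliff_drop]); these x fill an interval of length l,
    so each moment of the increment is at least of order l at such times
    ([mean_incr_ge]).  The set of these times has measure at least C.

    The one-sided Lipschitz estimate is a maximum principle, with the variables
    doubled so that neither the equation nor the nonlocal term has to be
    differentiated.  At a positive maximum over (t, x, y) of
    u(t, y) - u(t, x) - D (y - x) - eta t the two slopes equal D, so that the
    convection term has a sign because f' is nondecreasing, and
    z |-> u(t, z + y) - u(t, z + x) is maximal at z = 0, so that the dissipative
    term has a sign as soon as Lambda^alpha w >= 0 at a maximum of w.

    That positivity ([lim_Lambda_sum_ge0]) comes from the Levy-Khintchine
    formula: |k|^alpha is proportional to the integral over the real line of
    (1 - cos(2 pi k e^s)) e^(- alpha s), which converges for 0 < alpha < 2.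
    A partial sum of the series of Lambda^alpha w at the maximum is therefore an
    integral of partial Fourier sums of w(0) - (w(z) + w(-z)) / 2 >= 0, and these
    are bounded below by - O(1/N) (1 - cos(2 pi z)) ([sym_diff_sum_ge]).  The last
    bound rests on pointwise Fourier inversion for smooth periodic functions,
    proved with the Fejer kernel ([fourier_inversion]). *)

(** * Integrals over the circle *)

Section Mean.
Context {R : realType}.
Implicit Types (v w : R -> R) (a b : R).

Definition mean v : R := \int[lebesgue_measure]_(x in `[0%R, 1%R]) v x.

Lemma continuous_integrable_itv v a b : continuous v ->
  lebesgue_measure.-integrable `[a, b] (EFin \o v).
Proof.
move=> cv; apply: continuous_compact_integrable; first exact: segment_compact.
exact: continuous_subspaceT.
Qed.

Lemma Rintegral_cst_itv (r a b : R) : a <= b ->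
  \int[lebesgue_measure]_(x in `[a, b]) r = r * (b - a).
Proof.
move=> ab; rewrite Rintegral_cst//; congr (_ * _).
have -> : fine (lebesgue_measure (`[a, b]%classic : set R)) =
    fine (if (a < b)%R then b%:E - a%:E else 0)%E.
  by rewrite lebesgue_measure_itv.
case: ltP => //= ba; apply/esym/eqP; rewrite subr_eq0.
by rewrite eq_le ab ba.
Qed.

Lemma mean_cst a : mean (fun=> a) = a.
Proof. by rewrite /mean Rintegral_cst_itv ?subr0 ?mulr1. Qed.

Lemma eq_mean v w : (forall x, 0 <= x <= 1 -> v x = w x) -> mean v = mean w.
Proof. by move=> vw; apply: eq_Rintegral => x; rewrite inE/= in_itv/= => /vw. Qed.

Lemma meanD v w : continuous v -> continuous w ->
  mean (fun x => v x + w x) = mean v + mean w.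
Proof. by move=> cv cw; apply: RintegralD => //; exact: continuous_integrable_itv. Qed.

Lemma meanB v w : continuous v -> continuous w ->
  mean (fun x => v x - w x) = mean v - mean w.
Proof. by move=> cv cw; apply: RintegralB => //; exact: continuous_integrable_itv. Qed.

Lemma meanZ a v : continuous v -> mean (fun x => a * v x) = a * mean v.
Proof. by move=> cv; apply: RintegralZl => //; exact: continuous_integrable_itv. Qed.

Lemma mean_sum n (v_ : nat -> R -> R) : (forall k, continuous (v_ k)) ->
  mean (fun x => \sum_(k < n) v_ k x) = \sum_(k < n) mean (v_ k).
Proof.
move=> cv; elim: n => [|n IH].
  by under eq_mean do rewrite big_ord0; rewrite mean_cst big_ord0.
under eq_mean do rewrite big_ord_recr.
rewrite big_ord_recr/= meanD ?IH// => x.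
by apply: cvg_big => [|i _]; [exact: add_continuous|exact: cv].
Qed.

Lemma le_mean v w : continuous v -> continuous w ->
  (forall x, 0 <= x <= 1 -> v x <= w x) -> mean v <= mean w.
Proof.
move=> cv cw vw; by apply: le_Rintegral => //; exact: continuous_integrable_itv.
Qed.

Lemma mean_ge0 v : (forall x, 0 <= x <= 1 -> 0 <= v x) -> 0 <= mean v.
Proof. by move=> v0; apply: Rintegral_ge0 => x; rewrite /= in_itv/= => /v0. Qed.

Lemma norm_mean_le v w : continuous v -> continuous w ->
  (forall x, 0 <= x <= 1 -> `|v x| <= w x) -> `|mean v| <= mean w.
Proof.
move=> cv cw vw; apply: (le_trans (le_normr_Rintegral _ _)) => //.
  exact: continuous_integrable_itv.
by apply: le_mean => // x; apply: continuous_comp; [exact: cv|exact: norm_continuous].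
Qed.

Lemma Rintegral_FTC v V a b : a < b -> continuous v ->
  (forall x, is_derive x (1 : R) V (v x)) ->
  \int[lebesgue_measure]_(x in `[a, b]) v x = V b - V a.
Proof.
move=> ab cv dV; rewrite /Rintegral (@continuous_FTC2 _ v V)//.
- exact: continuous_subspaceT.
- have cV x : {for x, continuous V}.
    apply/differentiable_continuous/derivable1_diffP.
    by have [] := dV x.
  split; first by move=> x _; have [] := dV x.
    exact/cvg_at_right_filter/cV.
  exact/cvg_at_left_filter/cV.
- by move=> x _; rewrite derive1E; have [] := dV x.
Qed.

Lemma Rintegral_shift v a b c : continuous v -> a <= b ->
  \int[lebesgue_measure]_(x in `[a + c, b + c]) v x =
  \int[lebesgue_measure]_(x in `[a, b]) v (x + c).
Proof.
move=> cv ab; congr fine.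
have dF x : is_derive x (1 : R) (fun y : R => y + c) 1.
  by apply: is_derive_eq; rewrite addr0.
have dE : (fun y : R => y + c)^`() = fun=> 1.
  by apply/funext => x; rewrite derive1E; have [] := dF x.
rewrite (@integration_by_substitution_increasing _ (fun x => x + c)) ?dE//.
- by apply: eq_integral => x _; rewrite /= mulr1.
- by move=> x y _ _; rewrite ltrD2r.
- by move=> x _; exact: cvg_cst.
- exact: is_cvg_cst.
- exact: is_cvg_cst.
- have cF x : {for x, continuous (fun y : R => y + c)}.
    by apply: cvgD; [exact: cvg_id|exact: cvg_cst].
  split; first by move=> x _; have [] := dF x.
    exact/cvg_at_right_filter/cF.
  exact/cvg_at_left_filter/cF.
- exact: continuous_subspaceT.
Qed.

Lemma periodic_intr v : periodic v 1 -> forall (z : int) x, v (x + z%:~R) = v x.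
Proof.
move=> pv [n|n] x; first by rewrite -(periodicn pv n x).
rewrite NegzE mulrNz; set y := x - _.
by rewrite -[in RHS](subrK n.+1%:R x) (periodicn pv n.+1 y).
Qed.

Lemma continuous_shift v c : continuous v -> continuous (fun x => v (x + c)).
Proof.
move=> cv x; apply: (@continuous_comp _ _ _ (fun x => x + c)); last exact: cv.
by apply: cvgD; [exact: cvg_id|exact: cvg_cst].
Qed.

(** The shift is reduced to 0 <= c < 1 by periodicity; the part of [c, 1 + c]
    beyond 1 is then moved back to [0, c]. *)
Lemma mean_shift v c : continuous v -> periodic v 1 ->
  mean (fun x => v (x + c)) = mean v.
Proof.
move=> cv pv.
wlog /andP[c0 c1] : c / 0 <= c < 1.
  move=> H.
  have /andP[l r] := floor_itv c.
  rewrite -(H (c - (Num.floor c)%:~R)); last first.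
    by rewrite subr_ge0 l/= ltrBlDl -intrD1.
  apply: eq_mean => x _.
  by rewrite -(periodic_intr pv (Num.floor c) (x + (c - _))) -addrA subrK.
rewrite /mean -Rintegral_shift// add0r.
have i1 := @continuous_integrable_itv v c (1 + c) cv.
have i2 := @continuous_integrable_itv v 0 1 cv.
have i3 := @continuous_integrable_itv (fun x => v (x + 1)) 0 c (continuous_shift cv).
have -> : \int[lebesgue_measure]_(x in `[c, 1 + c]) v x =
   \int[lebesgue_measure]_(x in `[c, 1]) v x + \int[lebesgue_measure]_(x in `[0, c]) v x.
  have := @Rintegral_itvB _ v (BLeft c) (BRight (1 + c)) 1 i1.
  rewrite !bnd_simp => /(_ (ltW c1)) /=.
  rewrite lerDl => /(_ c0) => e.
  rewrite -(subrK (\int[lebesgue_measure]_(t in `[c, 1]) v t) (\int[lebesgue_measure]_(x in `[c, 1 + c]) v x)).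
  rewrite e addrC; congr (_ + _).
  rewrite Rintegral_itv_obnd_cbnd; last first.
    by apply: integrableS (continuous_integrable_itv 1 (1 + c) cv) => //; exact: subset_itv_oc_cc.
  rewrite -[X in `[X, _]]add0r (addrC 1 c) Rintegral_shift//.
  by apply: eq_Rintegral => x _; rewrite pv.
have := @Rintegral_itvB _ v (BLeft 0) (BRight 1) c i2.
rewrite !bnd_simp => /(_ c0 (ltW c1)) /=.
rewrite Rintegral_itv_obnd_cbnd; last first.
  by apply: integrableS (continuous_integrable_itv c 1 cv) => //; exact: subset_itv_oc_cc.
by move=> <-; rewrite subrK.
Qed.

Lemma mean_FTC v V : continuous v -> (forall x, is_derive x (1 : R) V (v x)) ->
  mean v = V 1 - V 0.
Proof. by move=> cv dV; apply: Rintegral_FTC. Qed.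

End Mean.

(** * Calculus of smooth periodic functions *)

Section Circle.
Context {R : realType}.
Implicit Types (v w : R -> R) (k n N : nat) (x y z : R).

Lemma continuousMr v w : continuous v -> continuous w -> continuous (fun x => v x * w x).
Proof. by move=> cv cw x; apply: cvgM; [exact: cv|exact: cw]. Qed.

Lemma is_derive_continuous v v' : (forall x, is_derive x (1 : R) v (v' x)) -> continuous v.
Proof.
move=> dv x; apply/differentiable_continuous/derivable1_diffP.
by have [] := dv x.
Qed.

Lemma is_derive_shift v v' (c x : R) : (forall y, is_derive y (1 : R) v (v' y)) ->
  is_derive x (1 : R) (fun y => v (y + c)) (v' (x + c)).
Proof.
move=> dv; have h : is_derive x (1 : R) (fun y : R => y + c) 1.
  by apply: is_derive_eq; rewrite addr0.
by rewrite -[v' _]mulr1; exact: (@is_derive1_comp _ v (fun y => y + c) x).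
Qed.

Lemma is_derive_sinM (a x : R) : is_derive x (1 : R) (fun y => sin (a * y)) (a * cos (a * x)).
Proof.
rewrite mulrC.
have h : is_derive x (1 : R) (fun y : R => a * y) a.
  by apply: is_derive_eq; rewrite /GRing.scale/= mulr1.
exact: (@is_derive1_comp _ sin (fun y => a * y) x (cos (a * x)) a).
Qed.

Lemma is_derive_cosM (a x : R) : is_derive x (1 : R) (fun y => cos (a * y)) (- (a * sin (a * x))).
Proof.
rewrite mulrC -mulNr.
have h : is_derive x (1 : R) (fun y : R => a * y) a.
  by apply: is_derive_eq; rewrite /GRing.scale/= mulr1.
exact: (@is_derive1_comp _ cos (fun y => a * y) x (- sin (a * x)) a).
Qed.

Lemma continuous_cosM (a : R) : continuous (fun y : R => cos (a * y)).
Proof. exact: (is_derive_continuous (is_derive_cosM a)). Qed.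

Lemma continuous_sinM (a : R) : continuous (fun y : R => sin (a * y)).
Proof. exact: (is_derive_continuous (is_derive_sinM a)). Qed.

Lemma cos_2pik k x : cos (2 * pi * k%:R + x) = cos x.
Proof.
have -> : 2 * pi * k%:R + x = x + pi *+ 2 *+ k.
  by rewrite addrC -(mulr_natl pi) mulr_natr.
exact: (periodicn (@cosD2pi R)).
Qed.

Lemma sin_2pik k x : sin (2 * pi * k%:R + x) = sin x.
Proof.
have -> : 2 * pi * k%:R + x = x + pi *+ 2 *+ k.
  by rewrite addrC -(mulr_natl pi) mulr_natr.
exact: (periodicn (@sinD2pi R)).
Qed.

Lemma periodic_reduce v x : periodic v 1 -> exists2 y, 0 <= y <= 1 & v x = v y.
Proof.
move=> pv; exists (x - (Num.floor x)%:~R).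
  have /andP[l r] := floor_itv x.
  by rewrite subr_ge0 l/= lerBlDl -intrD1 ltW.
by rewrite -[in RHS](periodic_intr pv (Num.floor x)) subrK.
Qed.

Lemma periodic_max v : continuous v -> periodic v 1 ->
  exists2 x, 0 <= x <= 1 & forall y, v y <= v x.
Proof.
move=> cv pv.
have [c c01 cM] := EVT_max (@ler01 R) (continuous_subspaceT cv).
exists c; first by move: c01; rewrite in_itv.
by move=> y; have [z z01 ->] := periodic_reduce y pv; exact: cM.
Qed.

Lemma periodic_bounded v : continuous v -> periodic v 1 ->
  exists2 M, 0 <= M & forall y, `|v y| <= M.
Proof.
move=> cv pv.
have cn : continuous (fun x => `|v x|).
  by move=> x; apply: continuous_comp; [exact: cv|exact: norm_continuous].
have [x _ xM] : exists2 x : R, 0 <= x <= 1 & forall y, `|v y| <= `|v x|.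
  by apply: (@periodic_max (fun x => `|v x|)) => // x; rewrite pv.
by exists `|v x|.
Qed.

Lemma norm_MVT_le (u u1 : R -> R) (B a b : R) :
  (forall x, is_derive x (1 : R) u (u1 x)) ->
  (forall x, Num.min a b <= x <= Num.max a b -> `|u1 x| <= B) ->
  `|u b - u a| <= B * `|b - a|.
Proof.
move=> du uB.
have cu := is_derive_continuous du.
have [ab|ba|->] := ltgtP a b; last first.
- by rewrite !subrr normr0 mulr0.
- have [c] := MVT ba (fun x _ => du x) (continuous_subspaceT cu).
  rewrite in_itv/= => /andP[bc ca].
  rewrite distrC => ->; rewrite normrM [in leRHS]distrC ler_wpM2r//.
  by apply: uB; rewrite ge_min le_max (ltW bc) (ltW ca) !orbT.
- have [c] := MVT ab (fun x _ => du x) (continuous_subspaceT cu).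
  rewrite in_itv/= => /andP[ac cb].
  move=> ->; rewrite normrM ler_wpM2r//.
  by apply: uB; rewrite ge_min le_max (ltW ac) (ltW cb) !orbT.
Qed.

(** The factor 1/2 of the Taylor bound is dropped, which lets the estimate follow
    from two uses of the mean value inequality. *)
Lemma taylor2 v v1 v2 (M z y : R) :
  (forall x, is_derive x (1 : R) v (v1 x)) ->
  (forall x, is_derive x (1 : R) v1 (v2 x)) ->
  (forall x, `|v2 x| <= M) -> v z = 0 -> v1 z = 0 ->
  `|v y| <= M * (y - z) ^+ 2.
Proof.
move=> dv dv1 v2M vz v1z.
rewrite -[v y]subr0 -vz (@le_trans _ _ (M * `|y - z| * `|y - z|))//; last first.
  by rewrite -mulrA -expr2 real_normK// num_real.
apply: (norm_MVT_le dv) => x xyz.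
rewrite -[v1 x]subr0 -v1z (le_trans (@norm_MVT_le _ _ M z x dv1 _))// ler_wpM2l//.
  by apply: (le_trans _ (v2M 0)).
by move: xyz; rewrite minEle maxEle; case: (leP z y) => zy /andP[h1 h2];
  [rewrite !ger0_norm//; lra|rewrite !ler0_norm//; lra].
Qed.

(** Concavity argument: the difference of the two sides vanishes at 0 and at 1/2,
    so a negative value in between would force its derivative, which is
    decreasing, to be negative and later positive. *)
Lemma sin_ge2 y : 0 <= y <= 2^-1 -> 2 * y <= sin (pi * y).
Proof.
move=> /andP[y0 yh].
rewrite leNgt; apply/negP => H.
pose g (x : R) := sin (pi * x) - 2 * x.
have dg x : is_derive x (1 : R) g (pi * cos (pi * x) - 2).
  have := is_derive_sinM (pi : R) x => ?.
  by apply: is_derive_eq; rewrite /GRing.scale/= mulr1.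
have cg := is_derive_continuous dg.
have g0 : g 0 = 0 by rewrite /g !mulr0 sin0 subrr.
have g1 : g 2^-1 = 0 by rewrite /g sin_pihalf divff// subrr.
have gy : g y < 0 by rewrite /g subr_lt0.
have y00 : 0 < y.
  by rewrite lt_neqAle y0 andbT; apply/eqP => y_0; move: gy; rewrite -y_0 g0 ltxx.
have yh1 : y < 2^-1.
  by rewrite lt_neqAle yh andbT; apply/eqP => y_0; move: gy; rewrite y_0 g1 ltxx.
have [a] := MVT y00 (fun x _ => dg x) (continuous_subspaceT cg).
rewrite in_itv/= => /andP[a0 ay] ea.
have [b] := MVT yh1 (fun x _ => dg x) (continuous_subspaceT cg).
rewrite in_itv/= => /andP[yb bh] eb.
have pi0 := @pi_gt0 R.
have : cos (pi * b) < cos (pi * a).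
  rewrite ltr_cos ?in_itv/=.
  - by rewrite ltr_pM2l//; lra.
  - by apply/andP; split; [nra|rewrite ger_pMr//; lra].
  - by apply/andP; split; [nra|rewrite ger_pMr//; lra].
rewrite -(ltr_pM2l pi0) => cab.
have : pi * cos (pi * a) - 2 < 0.
  rewrite -(pmulr_llt0 _ (_ : 0 < y - 0)); last by rewrite subr0.
  by rewrite -ea g0 subr0.
have : 0 < pi * cos (pi * b) - 2.
  rewrite -(pmulr_lgt0 _ (_ : 0 < 2^-1 - y)); last by rewrite subr_gt0.
  by rewrite -eb g1 sub0r oppr_gt0.
lra.
Qed.

End Circle.
Arguments continuous_cosM {R} a x.
Arguments continuous_sinM {R} a x.

(** * Cosine coefficients and the Fejer kernel *)

Section Fourier.
Context {R : realType}.
Implicit Types (v w : R -> R) (k n N : nat) (x y z : R).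

(** For a shifted function [fun y => v (y + x)] this is the real part of
    \hat v^k exp(2 pi i k x), so cosine coefficients alone suffice to evaluate
    Fourier multipliers with even real symbols pointwise. *)
Definition cos_coef k v : R := mean (fun y => v y * cos (2 * pi * k%:R * y)).

(** The symmetric partial Fourier sum over -N <= k <= N, evaluated at 0. *)
Definition fourier_sum N v : R := cos_coef 0 v + \sum_(k < N) 2 * cos_coef k.+1 v.

Definition dirichlet N y : R := 1 + \sum_(k < N) 2 * cos (2 * pi * k.+1%:R * y).

Lemma cos_coef0 v : cos_coef 0 v = mean v.
Proof. by apply: eq_mean => x _; rewrite mulr0 mul0r cos0 mulr1. Qed.

Lemma cos_coefB k v w : continuous v -> continuous w ->
  cos_coef k (fun x => v x - w x) = cos_coef k v - cos_coef k w.
Proof.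
move=> cv cw; rewrite -meanB; last 2 first.
- exact: continuousMr cv (continuous_cosM _).
- exact: continuousMr cw (continuous_cosM _).
by apply: eq_mean => x _; rewrite mulrBl.
Qed.

(** The function v sin(a x) / a + v1 cos(a x) / a^2 is a primitive of
    (v + v2 / a^2) cos(a x), and takes the same value at 0 and at 1. *)
Lemma cos_coef_ibp k v v1 v2 :
  (forall x, is_derive x (1 : R) v (v1 x)) ->
  (forall x, is_derive x (1 : R) v1 (v2 x)) -> continuous v2 ->
  v1 1 = v1 0 ->
  cos_coef k.+1 v = - cos_coef k.+1 v2 / (2 * pi * k.+1%:R) ^+ 2.
Proof.
move=> dv dv1 cv2 v110.
set a := 2 * pi * k.+1%:R.
have a0 : a != 0 by rewrite !mulf_neq0// gt_eqF// pi_gt0.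
have ca : cos (a * 1) = 1 by rewrite mulr1 -[a]addr0 cos_2pik cos0.
have sa : sin (a * 1) = 0 by rewrite mulr1 -[a]addr0 sin_2pik sin0.
pose F x := v x * (a^-1 * sin (a * x)) + v1 x * (a ^- 2 * cos (a * x)).
have dF x : is_derive x (1 : R) F (v x * cos (a * x) + a ^- 2 * (v2 x * cos (a * x))).
  have h1 := is_derive_sinM a x.
  have h2 := is_derive_cosM a x.
  have h3 := dv x. have h4 := dv1 x.
  have h5 : is_derive x (1 : R) (fun x : R => a^-1 * sin (a * x)) (cos (a * x)).
    by apply: is_derive_eq; rewrite /GRing.scale/= mulKf.
  have h6 : is_derive x (1 : R) (fun x : R => a^-2 * cos (a * x)) (- (a^-1 * sin (a * x))).
    by apply: is_derive_eq; rewrite /GRing.scale/=; field.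
  have h7 : is_derive x (1 : R) (fun x => v x * (a^-1 * sin (a * x))) (v x * cos (a * x) + a^-1 * sin (a * x) * v1 x).
    exact: is_deriveM.
  have h8 : is_derive x (1 : R) (fun x => v1 x * (a^-2 * cos (a * x))) (v1 x * - (a^-1 * sin (a * x)) + a^-2 * cos (a * x) * v2 x).
    exact: is_deriveM.
  by apply: is_derive_eq; ring.
have cv := is_derive_continuous dv.
have c1 := continuousMr cv (continuous_cosM a).
have c2 := continuousMr cv2 (continuous_cosM a).
have c3 : continuous (fun x => a ^- 2 * (v2 x * cos (a * x))).
  by apply: continuousMr => //; exact: cst_continuous.
have := mean_FTC _ dF.
rewrite meanD// meanZ// -/(cos_coef k.+1 v) -/(cos_coef k.+1 v2) => H.
have : cos_coef k.+1 v + a ^- 2 * cos_coef k.+1 v2 = 0.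
rewrite H; first by rewrite /F ca sa !mulr0 sin0 cos0 v110; ring.
  by move=> x; apply: cvgD; [exact: c1|exact: c3].
by move/eqP; rewrite addr_eq0 => /eqP ->; rewrite mulNr mulrC.
Qed.

Lemma norm_cos_coef_le k v (M : R) : continuous v -> (forall x, `|v x| <= M) ->
  `|cos_coef k v| <= M.
Proof.
move=> cv vM; rewrite -[leRHS]mean_cst; apply: norm_mean_le.
- exact: continuousMr cv (continuous_cosM _).
- exact: cst_continuous.
- by move=> x _; rewrite normrM -[leRHS]mulr1 ler_pM// cos_max.
Qed.

Lemma dirichletE N y : sin (pi * y) * dirichlet N y = sin (pi * (N.*2.+1)%:R * y).
Proof.
elim: N => [|N IH]; first by rewrite /dirichlet big_ord0 addr0 mulr1 mulr1.
rewrite /dirichlet big_ord_recr/= addrA mulrDr -/(dirichlet N y) IH.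
have -> : pi * (N.*2.+1)%:R * y = 2 * pi * N.+1%:R * y - pi * y :> R.
  by rewrite -addn1 natrD -muln2 natrM -[in RHS]addn1 natrD; ring.
have -> : pi * (N.+1.*2.+1)%:R * y = 2 * pi * N.+1%:R * y + pi * y :> R.
  by rewrite -[(N.+1).*2.+1]addn1 natrD -muln2 natrM; ring.
by rewrite sinB sinD; ring.
Qed.

(** The Dirichlet kernel is sin((2n+1) pi y) / sin(pi y), so the product
    telescopes.  Keeping the factor sin^2 on the left avoids the division: the
    Fejer kernel is only ever tested against functions bounded by sin^2. *)
Lemma fejerE N y :
  sin (pi * y) ^+ 2 * (\sum_(n < N) dirichlet n y) = sin (pi * N%:R * y) ^+ 2.
Proof.
elim: N => [|N IH]; first by rewrite big_ord0 !mulr0 mul0r sin0 expr0n.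
rewrite big_ord_recr/= mulrDr IH (expr2 (sin (pi * y))) -(mulrA (sin (pi * y))) dirichletE.
have -> : pi * (N.*2.+1)%:R * y = pi * N%:R * y + (pi * N%:R * y + pi * y) :> R.
  by rewrite -addn1 natrD -muln2 natrM; ring.
have -> : pi * N.+1%:R * y = pi * N%:R * y + pi * y :> R.
  by rewrite -addn1 natrD; ring.
rewrite sinD (sinD _ (pi * y)) (cosD _ (pi * y)).
have := cos2Dsin2 (pi * N%:R * y); have := cos2Dsin2 (pi * y).
set a := sin _; set b := cos _; set c := cos (pi * N%:R * y); set d := sin (pi * N%:R * y).
move=> h1 h2.
apply/eqP; rewrite -subr_eq0.
rewrite (_ : _ - _ = d ^+ 2 * (1 - (b ^+ 2 + a ^+ 2))); last by ring.
by rewrite h1 subrr mulr0.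
Qed.

Lemma continuous_dirichlet N : continuous (dirichlet N).
Proof.
move=> x; apply: cvgD; first exact: cvg_cst.
apply: cvg_big => [|i _]; first exact: add_continuous.
by apply: cvgM; [exact: cvg_cst|exact: continuous_cosM].
Qed.

Lemma fourier_sumE N v : continuous v -> fourier_sum N v = mean (fun y => v y * dirichlet N y).
Proof.
move=> cv; have cc k := continuousMr cv (continuous_cosM (2 * pi * k%:R)).
have c2 k : continuous (fun y => 2 * (v y * cos (2 * pi * k%:R * y))).
  by apply: continuousMr => //; exact: cst_continuous.
rewrite /fourier_sum cos_coef0.
under eq_bigr do rewrite /cos_coef -meanZ//.
rewrite -(mean_sum _ (fun k => c2 k.+1)) -meanD//; last first.
  move=> x; apply: cvg_big => [|i _]; first exact: add_continuous.
  exact: c2.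
apply: eq_mean => x _; rewrite /dirichlet (mulrDr (v x)) mulr1 mulr_sumr; congr (_ + _).
by apply: eq_bigr => i _; ring.
Qed.

Lemma mean_cos k : mean (fun y : R => cos (2 * pi * k.+1%:R * y)) = 0.
Proof.
set a := 2 * pi * k.+1%:R.
have a0 : a != 0 by rewrite !mulf_neq0// gt_eqF// pi_gt0.
have dV x : is_derive x (1 : R) (fun y => a^-1 * sin (a * y)) (cos (a * x)).
  have h := is_derive_sinM a x; apply: is_derive_eq; rewrite /GRing.scale/=.
  by rewrite mulKf.
rewrite (mean_FTC (continuous_cosM a) dV).
rewrite mulr1 mulr0; have := sin_2pik k.+1 (0 : R); rewrite addr0 -/a => ->.
by rewrite subrr.
Qed.

Lemma mean_sin k : mean (fun y : R => sin (2 * pi * k%:R * y)) = 0.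
Proof.
case: k => [|k].
  rewrite -[RHS](mean_cst (0 : R)).
  by apply: eq_mean => x _; rewrite mulr0 mul0r sin0.
set a := 2 * pi * k.+1%:R.
have a0 : a != 0 by rewrite !mulf_neq0// gt_eqF// pi_gt0.
have dV x : is_derive x (1 : R) (fun y => - a^-1 * cos (a * y)) (sin (a * x)).
  have h := is_derive_cosM a x; apply: is_derive_eq; rewrite /GRing.scale/=.
  by field.
rewrite (mean_FTC (continuous_sinM a) dV) mulr1 mulr0.
by have := cos_2pik k.+1 (0 : R); rewrite addr0 -/a => ->; rewrite subrr.
Qed.

Lemma fourier_sum_cst N (a : R) : fourier_sum N (fun=> a) = a.
Proof.
rewrite /fourier_sum cos_coef0 mean_cst big1 ?addr0// => i _.
by rewrite /cos_coef meanZ ?mean_cos ?mulr0//; exact: continuous_cosM.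
Qed.

(** Odd functions are invisible at the origin; this one is used to cancel the first
    derivative of a function at 0. *)
Lemma fourier_sum_sin N : fourier_sum N (fun y => sin (2 * pi * y)) = 0.
Proof.
have ms : mean (fun y : R => sin (2 * pi * y)) = 0.
  by rewrite -[RHS](mean_sin 1); apply: eq_mean => x _; rewrite mulr1.
rewrite /fourier_sum cos_coef0 ms add0r big1// => k _.
rewrite /cos_coef (_ : mean _ = mean (fun y : R => 2^-1 * (sin (2 * pi * k.+2%:R * y) - sin (2 * pi * k%:R * y)))).
  rewrite meanZ; last first.
    by move=> x; apply: cvgB; exact: continuous_sinM.
  by rewrite meanB ?mean_sin ?subrr ?mulr0//; exact: continuous_sinM.
apply: eq_mean => x _.
have -> : 2 * pi * (k.+2)%:R * x = 2 * pi * k.+1%:R * x + 2 * pi * x :> R.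
  by rewrite -[k.+2]addn1 natrD; ring.
have -> : 2 * pi * k%:R * x = 2 * pi * k.+1%:R * x - 2 * pi * x :> R.
  by rewrite -[k.+1]addn1 natrD; ring.
by rewrite sinD sinB; field.
Qed.

Lemma fourier_sumB N v w : continuous v -> continuous w ->
  fourier_sum N (fun x => v x - w x) = fourier_sum N v - fourier_sum N w.
Proof.
move=> cv cw; rewrite /fourier_sum cos_coefB//.
under eq_bigr do rewrite cos_coefB// mulrBr.
by rewrite sumrB; ring.
Qed.

Lemma fourier_sumZ N (a : R) v : continuous v ->
  fourier_sum N (fun x => a * v x) = a * fourier_sum N v.
Proof.
move=> cv; have E k : cos_coef k (fun x => a * v x) = a * cos_coef k v.
  rewrite /cos_coef -meanZ; last exact: continuousMr cv (continuous_cosM _).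
  by apply: eq_mean => x _; rewrite mulrA.
rewrite /fourier_sum E mulrDr mulr_sumr; congr (_ + _).
by apply: eq_bigr => i _; rewrite E mulrCA.
Qed.

(** A function with a double zero at the integers is dominated by sin^2(pi x), which
    cancels the singularity of the Fejer kernel: the Cesaro sums stay bounded
    uniformly in N. *)
Lemma norm_sum_fourier_sum_le v v1 v2 (M : R) N : periodic v 1 -> periodic v1 1 ->
  (forall x, is_derive x (1 : R) v (v1 x)) ->
  (forall x, is_derive x (1 : R) v1 (v2 x)) ->
  (forall x, `|v2 x| <= M) -> v 0 = 0 -> v1 0 = 0 ->
  `|\sum_(n < N) fourier_sum n v| <= M.
Proof.
move=> pv pv1 dv dv1 v2M v0 v10.
have M0 : 0 <= M by exact: (le_trans _ (v2M 0)).
have cv := is_derive_continuous dv.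
have bound x : 0 <= x <= 1 -> `|v x| <= M * sin (pi * x) ^+ 2.
  move=> /andP[x0 x1].
  have [xh|xh] := leP x 2^-1.
    rewrite (le_trans (taylor2 x dv dv1 v2M v0 v10))// ler_wpM2l// subr0.
    have : 2 * x <= sin (pi * x) by apply: sin_ge2; rewrite x0.
    by move=> ?; rewrite ler_sqr ?nnegrE; lra.
  have v1' : v 1 = 0 by rewrite -[1]add0r pv.
  have v11 : v1 1 = 0 by rewrite -[1]add0r pv1.
  rewrite (le_trans (taylor2 x dv dv1 v2M v1' v11))// ler_wpM2l//.
  have : 2 * (1 - x) <= sin (pi * (1 - x)) by apply: sin_ge2; lra.
  rewrite (mulrBr pi) mulr1 sinB sinpi cospi mul0r sub0r mulN1r opprK.
  by move=> ?; rewrite -sqrrN opprB ler_sqr ?nnegrE; lra.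
have cD n := continuousMr cv (@continuous_dirichlet n).
under eq_bigr do rewrite fourier_sumE//.
rewrite -(mean_sum _ cD) -[leRHS]mean_cst; apply: norm_mean_le.
- move=> x; apply: cvg_big => [|i _]; first exact: add_continuous.
  exact: cD.
- exact: cst_continuous.
move=> x /bound vx; rewrite -mulr_sumr normrM.
rewrite (le_trans (ler_wpM2r _ vx))// -mulrA -[leRHS]mulr1 ler_wpM2l//.
rewrite -[sin (pi * x) ^+ 2]ger0_norm ?sqr_ge0// -normrM fejerE.
by rewrite ger0_norm ?sqr_ge0// -real_normK ?num_real// expr_le1// sin_max.
Qed.

End Fourier.

(** * Pointwise Fourier inversion *)

Section Inversion.
Context {R : realType}.
Implicit Types (v w : R -> R) (k n N : nat) (x y z : R).

(** Comparison with the telescoping series of 2 / k - 2 / (k + 1). *)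
Lemma sum_invsq_tail N n : (N <= n)%N ->
  \sum_(N <= k < n) (k.+1%:R ^- 2 : R) <= 2 / N.+1%:R.
Proof.
move=> Nn; apply: (@le_trans _ _ (2 * (N.+1%:R^-1 - n.+1%:R^-1))); last first.
  by rewrite ler_wpM2l// gerBl invr_ge0.
elim: n Nn => [|n IH]; first by rewrite leqn0 => /eqP ->; rewrite big_geq// subrr mulr0.
rewrite leq_eqVlt => /predU1P[->|]; first by rewrite big_geq// subrr mulr0.
rewrite ltnS => Nn; rewrite big_nat_recr//=.
rewrite (le_trans (lerD (IH Nn) (lexx _)))//.
have n0 : (0 : R) <= n%:R by rewrite ler0n.
rewrite -[n.+2]addn2 -[n.+1]addn1 !natrD.
rewrite -subr_ge0 (_ : _ - _ = n%:R / ((n%:R + 1) ^+ 2 * (n%:R + 2))); last first.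
  have N0 : (0 : R) <= N%:R by rewrite ler0n.
  by field; repeat (apply/andP; split); rewrite ?gt_eqF//; lra.
by apply: divr_ge0 => //; rewrite mulr_ge0 ?sqr_ge0//; lra.
Qed.

Lemma is_cvg_sum_invsq (a : nat -> R) (A : R) : (forall k, `|a k| <= A / k.+1%:R ^+ 2) ->
  cvgn (fun n => \sum_(k < n) a k).
Proof.
move=> aA.
have A0 : 0 <= A by have := aA 0; rewrite expr1n divr1; exact: le_trans.
rewrite -[X in cvgn X]/([sequence \sum_(k < n) a k]_n) -seriesEord.
apply: normed_cvg; apply: nondecreasing_is_cvgn.
  by apply: nondecreasing_series => k _ _; exact: normr_ge0.
exists (A * 2) => _ [n _ <-].
rewrite /series/= (@le_trans _ _ (\sum_(0 <= k < n) A * k.+1%:R ^- 2))//.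
  by apply: ler_sum => k _; exact: aA.
rewrite -mulr_sumr ler_wpM2l// (le_trans (sum_invsq_tail (leq0n n)))//.
by rewrite divr1.
Qed.

Lemma is_derive_periodic v v1 : periodic v 1 ->
  (forall x, is_derive x (1 : R) v (v1 x)) -> periodic v1 1.
Proof.
move=> pv dv x.
have h1 := dv x; have h := is_derive_shift 1 x dv.
have e : (fun y => v (y + 1)) = v by apply/funext => y; rewrite pv.
rewrite e in h.
by have [_ <-] := h; have [_ ->] := h1.
Qed.

(** The two powers of k come from [cos_coef_ibp], and (2 pi)^2 >= 2 absorbs the
    factor 2 that accompanies each coefficient in a symmetric sum. *)
Lemma cos_coef_decay k v v1 v2 : periodic v 1 ->
  (forall x, is_derive x (1 : R) v (v1 x)) ->
  (forall x, is_derive x (1 : R) v1 (v2 x)) -> continuous v2 ->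
  2 * `|cos_coef k.+1 v| <= `|cos_coef k.+1 v2| / k.+1%:R ^+ 2.
Proof.
move=> pv dv dv1 cv2; have pv1 := is_derive_periodic pv dv.
rewrite (cos_coef_ibp k dv dv1)//; last by rewrite -[X in v1 X]add0r pv1.
rewrite mulNr normrN normrM normfV mulrCA ler_wpM2l//.
have k0 : 1 <= k.+1%:R :> R by rewrite ler1n.
have pi2 := @pi_ge2 R.
have a0 : 0 < (2 * pi * k.+1%:R) ^+ 2 :> R by rewrite exprn_gt0//; nra.
rewrite (ger0_norm (ltW a0)) ler_pdivrMr// (exprMn _ (2 * pi)) mulrCA.
by rewrite mulVf ?mulr1 ?gt_eqF ?exprn_gt0//; nra.
Qed.

(** The coefficients decay like k^(-2), so the partial sums converge and it is
    enough to identify the limit of their Cesaro means.  After subtraction of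
    v(0) + v'(0) sin(2 pi x) / (2 pi), whose partial sums at 0 all equal v(0),
    the function has a double zero and its Cesaro means are O(1/N). *)
Lemma fourier_inversion v v1 v2 : periodic v 1 ->
  (forall x, is_derive x (1 : R) v (v1 x)) ->
  (forall x, is_derive x (1 : R) v1 (v2 x)) -> continuous v2 ->
  fourier_sum N v @[N --> \oo] --> v 0.
Proof.
move=> pv dv dv1 cv2.
have pv1 := is_derive_periodic pv dv.
have pv2 := is_derive_periodic pv1 dv1.
have [M M0 v2M] := periodic_bounded cv2 pv2.
have cv := is_derive_continuous dv.
have cvg : cvgn (fun N => fourier_sum N v).
  suff /cvg_ex[l hl] : cvgn (fun n => \sum_(k < n) 2 * cos_coef k.+1 v).
    by apply: cvgP; apply: cvgD; [exact: cvg_cst|exact: hl].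
  apply: (@is_cvg_sum_invsq (fun k => 2 * cos_coef k.+1 v) M) => k.
  rewrite normrM ger0_norm// (le_trans (cos_coef_decay k pv dv dv1 cv2))//.
  by rewrite ler_wpM2r ?invr_ge0 ?exprn_ge0//; exact: norm_cos_coef_le.
(* r is v minus its value and its first-order part at 0 *)
set b := v1 0 / (2 * pi).
pose r x := v x - v 0 - b * sin (2 * pi * x).
pose r1 x := v1 x - v1 0 * cos (2 * pi * x).
pose r2 x := v2 x + v1 0 * (2 * pi * sin (2 * pi * x)).
have pi0 : pi != 0 :> R by rewrite gt_eqF// pi_gt0.
have dr x : is_derive x (1 : R) r (r1 x).
  have h1 := is_derive_sinM (2 * pi) x; have h2 := dv x.
  apply: is_derive_eq; rewrite /GRing.scale/= /r1 /b.
  by rewrite subr0 mulrA divfK ?mulf_neq0.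
have dr1 x : is_derive x (1 : R) r1 (r2 x).
  have h1 := is_derive_cosM (2 * pi) x; have h2 := dv1 x.
  by apply: is_derive_eq; rewrite /GRing.scale/= /r2; ring.
have pr : periodic r 1.
  move=> x; rewrite /r pv (_ : 2 * pi * (x + 1) = 2 * pi * 1%:R + 2 * pi * x); last by ring.
  by rewrite sin_2pik.
have pr1 := is_derive_periodic pr dr.
have r0 : r 0 = 0 by rewrite /r mulr0 sin0; ring.
have r10 : r1 0 = 0 by rewrite /r1 mulr0 cos0; ring.
have cr2 : continuous r2.
  move=> x; apply: cvgD; first exact: cv2.
  by apply: cvgM; [exact: cvg_cst|apply: cvgM; [exact: cvg_cst|exact: continuous_sinM]].
have pr2 := is_derive_periodic pr1 dr1.
have [B B0 rB] := periodic_bounded cr2 pr2.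
have fE N : fourier_sum N v = v 0 + fourier_sum N r.
  rewrite /r fourier_sumB.
  - rewrite fourier_sumB ?fourier_sum_cst//; last exact: cst_continuous.
    by rewrite fourier_sumZ ?fourier_sum_sin; [ring|exact: continuous_sinM].
  - by move=> x; apply: cvgB; [exact: cv|exact: cvg_cst].
  - by move=> x; apply: cvgM; [exact: cvg_cst|exact: continuous_sinM].
suff L : lim (fourier_sum N v @[N --> \oo]) = v 0 by rewrite -L.
have /cesaro := cvg; set L := lim _ => cL.
apply: (@cvg_unique _ (@norm_hausdorff _ R) _ _ L (v 0) cL).
rewrite -[v 0]addr0.
rewrite (_ : arithmetic_mean _ = (fun n => v 0 + n.+1%:R^-1 * \sum_(k < n.+1) fourier_sum k r)); last first.
  apply/funext => n; rewrite /arithmetic_mean/= /series/= big_mkord.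
  rewrite (eq_bigr (fun k : 'I_n.+1 => v 0 + fourier_sum k r)) => [|k _]; last exact: fE.
  rewrite big_split/= sumr_const card_ord mulrDr -[v 0 *+ _]mulr_natl mulKf//.
apply: cvgD; first exact: cvg_cst.
apply/norm_cvg0P.
apply: (@squeeze_cvgr _ _ _ _ (fun=> 0) (fun n => B * harmonic n)).
- apply: nearW => n; rewrite normr_ge0/= normrM ger0_norm ?invr_ge0// mulrC.
  rewrite ler_wpM2r// ?invr_ge0//; exact: (norm_sum_fourier_sum_le _ pr pr1 dr dr1).
- exact: cvg_cst.
- by rewrite -[0 in X in _ --> X](mulr0 B); apply: cvgM; [exact: cvg_cst|exact: cvg_harmonic].
Qed.

End Inversion.

(** * Levy-Khintchine formula for powers of the frequency *)

Section Levy.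
Context {R : realType}.
Implicit Types (k n N : nat) (x y z s alpha : R).

Lemma norm_sin_natmul k x : `|sin (k%:R * x)| <= k%:R * `|sin x|.
Proof.
elim: k => [|k IH]; first by rewrite !mul0r sin0 normr0.
rewrite -addn1 natrD mulrDl mul1r sinD mulrDl mul1r.
rewrite (le_trans (ler_normD _ _))// lerD//.
- by rewrite normrM (le_trans _ IH)// -[leRHS]mulr1 ler_wpM2l// cos_max.
- by rewrite normrM -[leRHS]mul1r ler_wpM2r// cos_max.
Qed.

Lemma one_sub_cos x : 1 - cos x = 2 * sin (x / 2) ^+ 2.
Proof.
have -> : cos x = cos ((x / 2) *+ 2) by rewrite -mulr_natr divfK.
by rewrite cos_mulr2n sin2cos2; ring.
Qed.

(** This bounds all frequencies by the lowest one, so that remainders can be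
    integrated against the Levy kernel with no further estimate. *)
Lemma one_sub_cos_natmul k x : 1 - cos (k%:R * x) <= k%:R ^+ 2 * (1 - cos x).
Proof.
rewrite !one_sub_cos (mulrCA (_ ^+ 2)) ler_wpM2l// -mulrA -exprMn.
rewrite -real_normK ?num_real// -[leRHS]real_normK ?num_real//.
by rewrite ler_sqr ?nnegrE// normrM (ger0_norm (ler0n R k)) norm_sin_natmul.
Qed.

Lemma one_sub_cos_ge0 x : 0 <= 1 - cos x.
Proof. by rewrite subr_ge0 cos_le1. Qed.

Lemma one_sub_cos_le2 x : 1 - cos x <= 2.
Proof. by rewrite lerBlDr -lerBlDl; have := cos_geN1 x; lra. Qed.

Lemma one_sub_cos_le_sqr x : 1 - cos x <= x ^+ 2.
Proof.
have d1 y : is_derive y (1 : R) (fun y : R => 1 - cos y) (sin y).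
  by apply: is_derive_eq; ring.
have d2 y : is_derive y (1 : R) (fun y : R => sin y) (cos y) by apply: is_derive_sin.
have h0 : 1 - cos (0 : R) = 0 by rewrite cos0 subrr.
have := taylor2 x d1 d2 (@cos_max R) h0 (@sin0 R).
by rewrite mul1r subr0 ger0_norm// one_sub_cos_ge0.
Qed.

(** The Levy density (1 - cos(a y)) y^(-1 - alpha) dy on the half-line in the
    variable s = ln y: dilations of y become translations of s, and the two ends
    of the line are governed by plain exponentials. *)
Definition levy alpha (a s : R) : R := (1 - cos (a * expR s)) * expR (- alpha * s).

Lemma levy_ge0 alpha a s : 0 <= levy alpha a s.
Proof. by rewrite mulr_ge0 ?one_sub_cos_ge0 ?expR_ge0. Qed.

Lemma continuous_expRM (a : R) : continuous (fun s : R => expR (a * s)).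
Proof.
move=> s; apply: (@continuous_comp _ _ _ (fun s => a * s)); last exact: continuous_expR.
by apply: cvgM; [exact: cvg_cst|exact: cvg_id].
Qed.

Lemma continuous_levy alpha (a : R) : continuous (levy alpha a).
Proof.
move=> s; apply: cvgM; last exact: continuous_expRM.
apply: cvgB; first exact: cvg_cst.
apply: (@continuous_comp _ _ _ (fun s => a * expR s)); last exact: continuous_cos.
by apply: cvgM; [exact: cvg_cst|exact: continuous_expR].
Qed.

Lemma measurable_levy alpha (a : R) (A : set R) : measurable_fun A (EFin \o levy alpha a).
Proof.
apply/measurable_EFinP; apply: measurable_funTS.
by apply: continuous_measurable_fun; exact: continuous_levy.
Qed.

(** Translating s by ln a turns the kernel of frequency 1 into that of frequency a,
    up to the factor a^alpha. *)
Lemma integral_levy_scale alpha (a : R) : 0 < a ->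
  (\int[lebesgue_measure]_s (levy alpha a s)%:E =
   (a `^ alpha)%:E * \int[lebesgue_measure]_s (levy alpha 1 s)%:E)%E.
Proof.
move=> a0.
have dF x : is_derive x (1 : R) (fun y : R => y + ln a) 1.
  by apply: is_derive_eq; rewrite addr0.
have dE : (fun y : R => y + ln a)^`() = fun=> 1.
  by apply/funext => x; rewrite derive1E; have [] := dF x.
have hE : a `^ alpha * expR (- alpha * ln a) = 1.
  by rewrite /powR gt_eqF// -expRD mulNr subrr expR0.
rewrite [in RHS](@increasing_ge0_integration_by_substitutionT _ (fun s => s + ln a)) ?dE.
- rewrite -ge0_integralZl//.
  + apply: eq_integral => s _; rewrite -EFinM; congr EFin.
    rewrite /levy fctE/= mulr1 mul1r expRD lnK ?posrE// (mulrC (expR s)) mulrCA; congr (_ * _).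
    by rewrite mulrDr expRD mulrCA hE mulr1.
  + rewrite (_ : (fun _ => _) = EFin \o (fun s => levy alpha 1 (s + ln a))); last first.
      by apply/funext => s; rewrite /= fctE mulr1.
    apply/measurable_EFinP; apply: continuous_measurable_fun.
    exact: (continuous_shift (@continuous_levy alpha 1)).
  + by move=> s _; rewrite /= lee_fin mulr1 levy_ge0.
  + by rewrite lee_fin powR_ge0.
- by move=> x y xy; rewrite ltrD2r.
- by move=> x; exact: cvg_cst.
- exact: is_cvg_cst.
- exact: is_cvg_cst.
- by move=> x; have [] := dF x.
- exact: cvg_addrr_Ny.
- exact: cvg_addrr.
- exact: continuous_levy.
- by move=> s; exact: levy_ge0.
Qed.

Lemma integral_expRM (b : R) : 0 < b ->
  (\int[lebesgue_measure]_(s in `[0%R, +oo[) (expR (- b * s))%:E = b^-1%:E)%E.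
Proof.
move=> b0.
have dF x : is_derive x (1 : R) (fun y : R => - b^-1 * expR (- b * y)) (expR (- b * x)).
  have h : is_derive x (1 : R) (fun y : R => - b * y) (- b).
    by apply: is_derive_eq; rewrite /GRing.scale/= mulr1.
  have h2 := (@is_derive1_comp _ expR (fun y => - b * y) x _ _ (is_derive_expR _) h).
  by apply: is_derive_eq; rewrite /GRing.scale/= mulrCA mulrNN mulVf ?mulr1// gt_eqF.
have cF := is_derive_continuous dF.
rewrite (@ge0_continuous_FTC2y _ (fun s => expR (- b * s)) (fun y : R => - b^-1 * expR (- b * y)) 0 0).
- by rewrite mulr0 expR0 mulr1 -EFinB sub0r opprK.
- by move=> x _; exact: expR_ge0.
- by apply: continuous_subspaceT; exact: continuous_expRM.
- rewrite -(mulr0 (- b^-1)); apply: cvgM; first exact: cvg_cst.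
  under eq_cvg do rewrite mulNr.
  apply: (cvg_comp _ _ _ (@cvgr_expR R)).
  exact: gt0_cvgMry.
- by move=> x _; have [] := dF x.
- exact/cvg_at_right_filter/cF.
- by move=> x _; rewrite derive1E; have [] := dF x.
Qed.

(** Near -oo the kernel is at most e^((2 - alpha) s) since 1 - cos y <= y^2, near +oo
    at most 2 e^(- alpha s). *)
Lemma integral_levy_fin alpha : 0 < alpha < 2 ->
  (\int[lebesgue_measure]_s (levy alpha 1 s)%:E < +oo)%E.
Proof.
move=> /andP[a0 a2].
have -> : [set: R] = `]-oo, 0%R] `|` `]0%R, +oo[.
  by rewrite -(@itv_bndbnd_setU _ _ -oo%O (BRight 0) +oo%O)// set_itvNyy.
rewrite ge0_integral_setU//=.
- rewrite lte_add_pinfty//.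
  + apply: (@le_lt_trans _ _ (\int[lebesgue_measure]_(s in `]-oo, (-0)%R]) (expR ((2 - alpha) * s))%:E)%E).
      rewrite oppr0; apply: ge0_le_integral => //.
      * by move=> s _; rewrite lee_fin levy_ge0.
      * exact: measurable_levy.
      * apply/measurable_EFinP; apply: measurable_funTS.
        by apply: continuous_measurable_fun; exact: continuous_expRM.
      * move=> s _; rewrite lee_fin /levy mul1r (_ : (2 - alpha) * s = 2 * s + - alpha * s) ?expRD; last by ring.
        rewrite ler_wpM2r ?expR_ge0// (le_trans (one_sub_cos_le_sqr _))//.
        by rewrite -expRM_natl.
    rewrite ge0_integration_by_substitutionNy; last 2 first.
    * by apply: continuous_subspaceT; exact: continuous_expRM.
    * by move=> s _; exact: expR_ge0.
    under eq_integral do rewrite /= mulrN -mulNr.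
    by rewrite integral_expRM ?ltry// subr_gt0.
  + apply: (@le_lt_trans _ _ (\int[lebesgue_measure]_(s in `[0%R, +oo[) (2 * expR (- alpha * s))%:E)%E).
      rewrite integral_itv_obnd_cbnd; last exact: measurable_levy.
      apply: ge0_le_integral => //.
      * by move=> s _; rewrite lee_fin levy_ge0.
      * exact: measurable_levy.
      * apply/measurable_EFinP; apply: measurable_funTS.
        apply: continuous_measurable_fun; apply: continuousMr; first exact: cst_continuous.
        exact: continuous_expRM.
      * by move=> s _; rewrite lee_fin /levy ler_wpM2r ?expR_ge0 ?one_sub_cos_le2.
    under eq_integral do rewrite EFinM.
    rewrite ge0_integralZl//.
    * by rewrite integral_expRM// -EFinM ltry.
    * apply/measurable_EFinP; apply: measurable_funTS.
      by apply: continuous_measurable_fun; exact: continuous_expRM.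
- exact: measurable_levy.
- by move=> s _; rewrite lee_fin levy_ge0.
- by apply/disj_setPS => s [/=]; rewrite !in_itv/= andbT leNgt => /negP.
Qed.

(** On [0, ln 2] the argument of the cosine runs through [1, 2], a subset of [0, pi]. *)
Lemma integral_levy_gt0 alpha :
  (0 < \int[lebesgue_measure]_s (levy alpha 1 s)%:E)%E.
Proof.
pose m : R := (1 - cos 1) * expR (- `|alpha|).
have m0 : 0 < m.
  rewrite mulr_gt0 ?expR_gt0// subr_gt0 -[ltRHS]cos0 ltr_cos ?in_itv/= ?ltr01//.
  + by have := @pi_ge2 R; move=> ?; apply/andP; split; lra.
  + by have := @pi_ge2 R; move=> ?; apply/andP; split; lra.
apply: (@lt_le_trans _ _ (\int[lebesgue_measure]_(s in `[0%R, ln 2]) m%:E)%E).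
  rewrite integral_cst//= lebesgue_measure_itv/= lte_fin ln_gt0 ?ltr1n//.
  by rewrite sube0 -EFinM lte_fin mulr_gt0// ln_gt0// ltr1n.
apply: (@le_trans _ _ (\int[lebesgue_measure]_(s in `[0%R, ln 2]) (levy alpha 1 s)%:E)%E); last first.
  apply: ge0_subset_integral => //; first exact: measurable_levy.
  by move=> s _; rewrite lee_fin levy_ge0.
apply: ge0_le_integral => //.
- by move=> s _; rewrite lee_fin ltW.
- exact: measurable_levy.
move=> s; rewrite /= in_itv/= => /andP[s0 s1]; rewrite lee_fin /levy mul1r.
have e1 : 1 <= expR s by rewrite -expR0 ler_expR.
have e2 : expR s <= 2 by rewrite -[leRHS]lnK ?posrE// ler_expR.
have pi2 := @pi_ge2 R.
apply: ler_pM; rewrite ?expR_ge0 ?one_sub_cos_ge0//.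
- rewrite lerD2l lerN2 leNgt ltr_cos ?in_itv/= -?leNgt//; apply/andP; split; lra.
- rewrite ler_expR mulNr lerN2.
  have l2 : ln 2 <= 1 :> R by rewrite -ler_expR lnK ?posrE// (le_trans _ (expR_ge1Dx _))//; lra.
  by have := ler_norm alpha; have := normr_ge0 alpha; nra.
Qed.

End Levy.

(** * The fractional Laplacian at a maximum *)

Section Lambda.
Context {R : realType}.
Implicit Types (v w : R -> R) (k n N : nat) (x y z s alpha : R).

Definition Lambda_sum alpha N v : R :=
  \sum_(k < N) 2 * (2 * pi * k.+1%:R) `^ alpha * cos_coef k.+1 v.

Lemma divr_exp4 (a b : R) : a / b ^+ 4 = a / b ^+ 2 / b ^+ 2.
Proof. by rewrite -mulrA -invfM -exprD. Qed.

Lemma sum_symm (G : nat -> R) N :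
  \sum_(i < N.*2.+1) G (absz ((i : nat)%:Z - N%:Z)) = G 0%N + \sum_(k < N) 2 * G k.+1.
Proof.
elim: N => [|N IH]; first by rewrite big_ord_recl !big_ord0.
rewrite doubleS big_ord_recr big_ord_recl /=.
transitivity (G N.+1 + \sum_(i < N.*2.+1) G (absz ((i : nat)%:Z - N%:Z)) + G N.+1).
  congr (G _ + _ + G _).
  - by rewrite subn0.
  - apply: eq_bigr => i _; congr (G (absz _)).
    by rewrite /bump/= add1n -[i.+1]addn1 -[N.+1]addn1 !PoszD opprD addrACA subrr addr0.
  - by rewrite -addnn -addSn -addnS PoszD addrK.
by rewrite IH big_ord_recr/=; ring.
Qed.

Lemma periodic_cos k (c : R) : periodic (fun y : R => cos (2 * pi * k%:R * (y + c))) 1.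
Proof.
move=> y; rewrite (_ : _ * (y + 1 + c) = 2 * pi * k%:R + 2 * pi * k%:R * (y + c)); last by ring.
by rewrite cos_2pik.
Qed.

Lemma cos_coef_shift k v z : continuous v -> periodic v 1 ->
  cos_coef k (fun y => v (y + z)) = mean (fun y => v y * cos (2 * pi * k%:R * (y - z))).
Proof.
move=> cv pv; rewrite -[RHS](mean_shift z).
- by apply: eq_mean => x _; rewrite addrK.
- by apply: continuousMr => //; exact: (continuous_shift (continuous_cosM _)).
- by move=> y; rewrite pv periodic_cos.
Qed.

(** In the symmetric sum that defines [Lambda] the terms k and -k agree, and k = 0
    contributes 0 because alpha <> 0. *)
Lemma LambdaE alpha v x : alpha != 0 -> continuous v -> periodic v 1 ->
  Lambda alpha v x = limn (fun N => Lambda_sum alpha N (fun y => v (y + x))).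
Proof.
move=> al0 cv pv; rewrite /Lambda; congr (lim (_ @ \oo)); apply/funext => N.
pose G n := (2 * pi * n%:R) `^ alpha * cos_coef n (fun y => v (y + x)).
have -> : Lambda_sum alpha N (fun y => v (y + x)) = G 0%N + \sum_(k < N) 2 * G k.+1.
  rewrite /G mulr0 powR0// mul0r add0r.
  by apply: eq_bigr => k _; rewrite mulrA.
rewrite -sum_symm; apply: eq_bigr => i _ /=.
set k := _ - _; rewrite /G.
have absk : `|k|%:~R = (absz k)%:R :> R by rewrite -abszE.
rewrite absk; congr (_ * _).
rewrite -/(mean _) -/(mean _) mulNr opprK.
rewrite cos_coef_shift//.
have cc := continuousMr cv (continuous_cosM (2 * pi * k%:~R)).
have cs := continuousMr cv (continuous_sinM (2 * pi * k%:~R)).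
rewrite (mulrC (mean _)) -meanZ// (mulrC (mean _)) -meanZ// -meanD; last 2 first.
- by apply: continuousMr => //; exact: cst_continuous.
- by apply: continuousMr => //; exact: cst_continuous.
apply: eq_mean => y _.
have -> : cos (2 * pi * (absz k)%:R * (y - x)) = cos (2 * pi * k%:~R * (y - x)).
  rewrite -[LHS]cos_norm -[RHS]cos_norm; congr cos.
  by rewrite !normrM -absk intr_norm normr_id.
by rewrite mulrBr cosB; ring.
Qed.

Section chain.
Variable W : nat -> R -> R.
Hypothesis dW : forall j x, is_derive x (1 : R) (W j) (W j.+1 x).
Hypothesis pW : periodic (W 0%N) 1.

Let cW j : continuous (W j).
Proof. exact: (is_derive_continuous (dW j)). Qed.

Let pWj j : periodic (W j) 1.
Proof. elim: j => [//|j IH]; exact: (is_derive_periodic IH (dW j)). Qed.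

Lemma cos_coef_decay4 : exists2 A : R, 0 <= A &
  forall k, 2 * `|cos_coef k.+1 (W 0%N)| <= A / k.+1%:R ^+ 4.
Proof.
have [M M0 WM] := periodic_bounded (@cW 4) (pWj 4).
exists M => // k.
rewrite (le_trans (cos_coef_decay k (pWj 0) (dW 0) (dW 1) (@cW 2)))//.
have := cos_coef_decay k (pWj 2) (dW 2) (dW 3) (@cW 4).
have := norm_cos_coef_le k.+1 (@cW 4) WM.
have k0 : 0 < k.+1%:R ^+ 2 :> R by rewrite exprn_gt0.
rewrite divr_exp4 => c4 c2.
rewrite ler_pM2r ?invr_gt0//.
apply: (@le_trans _ _ (2 * `|cos_coef k.+1 (W 2)|)).
  by rewrite ler_peMl// ler1n.
by rewrite (le_trans c2)// ler_pM2r ?invr_gt0.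
Qed.

Lemma is_cvg_Lambda_sum alpha : 0 <= alpha <= 2 -> cvgn (fun N => Lambda_sum alpha N (W 0%N)).
Proof.
move=> /andP[al0 al2]; have [A A0 WA] := cos_coef_decay4.
apply: (@is_cvg_sum_invsq _ (fun k => 2 * (2 * pi * k.+1%:R) `^ alpha * cos_coef k.+1 (W 0%N)) ((2 * pi) `^ alpha * A)) => k.
have k0 : 1 <= k.+1%:R :> R by rewrite ler1n.
rewrite mulrAC normrM [X in _ * X]ger0_norm ?powR_ge0// normrM ger0_norm//.
rewrite powRM ?mulr_ge0 ?pi_ge0// mulrCA -mulrA ler_wpM2l ?powR_ge0//.
have h : k.+1%:R `^ alpha <= k.+1%:R ^+ 2 :> R.
  by rewrite -powR_mulrn// ler_powR.
rewrite (le_trans (ler_pM _ _ (WA k) h)) ?mulr_ge0 ?powR_ge0//.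
by rewrite divr_exp4 divfK// gt_eqF// exprn_gt0.
Qed.

(** The symmetric second difference in z acts on cosine coefficients as the
    multiplier 1 - cos(2 pi k z). *)
Lemma cos_coef_sym_diff k z :
  cos_coef k (fun y => W 0%N y - 2^-1 * (W 0%N (y + z) + W 0%N (y + - z))) =
  (1 - cos (2 * pi * k%:R * z)) * cos_coef k (W 0%N).
Proof.
have cs c := continuous_shift (c := c) (@cW 0).
have cc c : continuous (fun y => W 0%N y * cos (2 * pi * k%:R * (y - c))).
  by apply: continuousMr; [exact: cW|exact: continuous_shift (continuous_cosM _)].
have ch : continuous (fun y => W 0%N (y + z) + W 0%N (y + - z)).
  by move=> y; apply: cvgD; exact: cs.
rewrite cos_coefB; [|exact: cW|]; last first.
  by apply: continuousMr => //; exact: cst_continuous.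
rewrite mulrBl mul1r; congr (_ - _).
transitivity (2^-1 * (cos_coef k (fun y => W 0%N (y + z)) + cos_coef k (fun y => W 0%N (y + - z)))).
  rewrite /cos_coef -meanD; last 2 first.
  - exact: continuousMr (cs z) (continuous_cosM _).
  - exact: continuousMr (cs (- z)) (continuous_cosM _).
  rewrite -meanZ; last first.
    by move=> y; apply: cvgD; apply: cvgM; [exact: cs|exact: continuous_cosM|exact: cs|exact: continuous_cosM].
  by apply: eq_mean => y _; ring.
rewrite !cos_coef_shift//.
rewrite -meanD// -meanZ; last by move=> y; apply: cvgD; exact: cc.
rewrite /cos_coef -meanZ; last exact: continuousMr (@cW 0) (continuous_cosM _).
apply: eq_mean => y _; rewrite opprK.
rewrite (_ : _ * (y - z) = 2 * pi * k%:R * y - 2 * pi * k%:R * z); last by ring.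
rewrite (_ : _ * (y + z) = 2 * pi * k%:R * y + 2 * pi * k%:R * z); last by ring.
by rewrite cosB cosD; field.
Qed.

Lemma fourier_sum_sym_diff N z :
  fourier_sum N (fun y => W 0%N y - 2^-1 * (W 0%N (y + z) + W 0%N (y + - z))) =
  \sum_(k < N) 2 * cos_coef k.+1 (W 0%N) * (1 - cos (2 * pi * k.+1%:R * z)).
Proof.
rewrite /fourier_sum cos_coef_sym_diff mulr0 mul0r cos0 subrr mul0r add0r.
by apply: eq_bigr => k _; rewrite cos_coef_sym_diff; ring.
Qed.

Hypothesis W_max : forall y, W 0%N y <= W 0%N 0.

(** The full series equals W(0) - (W(z) + W(-z)) / 2, which is nonnegative since 0 is
    a maximum, and its tail is controlled by [one_sub_cos_natmul] and the decay of
    the coefficients. *)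
Lemma sym_diff_sum_ge (A : R) N z :
  (forall k, 2 * `|cos_coef k.+1 (W 0%N)| <= A / k.+1%:R ^+ 4) ->
  0 <= \sum_(k < N) 2 * cos_coef k.+1 (W 0%N) * (1 - cos (2 * pi * k.+1%:R * z))
       + 2 * A / N.+1%:R * (1 - cos (2 * pi * z)).
Proof.
move=> WA; have A0 : 0 <= A.
  by have := WA 0; rewrite expr1n divr1; apply: le_trans; rewrite mulr_ge0.
pose T k := 2 * cos_coef k.+1 (W 0%N) * (1 - cos (2 * pi * k.+1%:R * z)).
set C := 1 - cos (2 * pi * z).
have C0 : 0 <= C by exact: one_sub_cos_ge0.
pose g j y := W j y - 2^-1 * (W j (y + z) + W j (y + - z)).
have dsh j c x : is_derive x (1 : R) (fun y => W j (y + c)) (W j.+1 (x + c)).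
  exact: is_derive_shift.
have dg j x : is_derive x (1 : R) (g j) (g j.+1 x).
  have h1 := dsh j z x; have h2 := dsh j (- z) x; have h3 := dW j x.
  by apply: is_derive_eq; rewrite /GRing.scale.
have pg : periodic (g 0%N) 1.
  by move=> y; rewrite /g !(addrAC _ 1) !pWj.
have cg := fourier_inversion pg (dg 0%N) (dg 1%N) (is_derive_continuous (dg 2%N)).
have g0 : 0 <= g 0%N 0.
  rewrite /g !add0r; have := W_max z; have := W_max (- z); lra.
have tail M : (N <= M)%N -> fourier_sum M (g 0%N) <= \sum_(k < N) T k + 2 * A / N.+1%:R * C.
  move=> NM; rewrite fourier_sum_sym_diff (_ : \sum_(k < M) _ = \sum_(0 <= k < M) T k); last by rewrite big_mkord.
  rewrite -(big_mkord xpredT T) (big_cat_nat (leq0n N) NM)/=.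
  rewrite lerD2l.
  apply: (@le_trans _ _ (\sum_(N <= k < M) A * C * k.+1%:R ^- 2)).
    apply: ler_sum => k _.
    have k0 : 0 < k.+1%:R ^+ 2 :> R by rewrite exprn_gt0.
    have h1 : 1 - cos (2 * pi * k.+1%:R * z) <= k.+1%:R ^+ 2 * C.
      rewrite (_ : 2 * pi * k.+1%:R * z = k.+1%:R * (2 * pi * z)); last by ring.
      exact: one_sub_cos_natmul.
    have h2 : 2 * cos_coef k.+1 (W 0%N) <= A / k.+1%:R ^+ 4.
      by rewrite (le_trans _ (WA k))// ler_wpM2l// ler_norm.
    have h3 := one_sub_cos_ge0 (2 * pi * k.+1%:R * z).
    rewrite /T (le_trans (ler_wpM2r h3 h2))//.
    rewrite (le_trans (ler_wpM2l _ h1)) ?divr_ge0 ?exprn_ge0//.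
    by rewrite divr_exp4 mulrA divfK ?gt_eqF// mulrAC.
  rewrite -mulr_sumr [leRHS](_ : _ = A * C * (2 / N.+1%:R)); last by ring.
  by rewrite ler_wpM2l ?mulr_ge0// sum_invsq_tail.
by apply: (le_trans g0); apply: (cvgr_to_le cg); exists N.
Qed.

Hypothesis (alpha : R) (alpha02 : 0 < alpha < 2).

(** Integrating [sym_diff_sum_ge] with z = e^s against e^(- alpha s) turns each
    factor 1 - cos(2 pi k z) into a fixed positive multiple J of (2 pi k)^alpha. *)
Lemma lim_Lambda_sum_ge0 : 0 <= limn (fun N => Lambda_sum alpha N (W 0%N)).
Proof.
have [A A0 WA] := cos_coef_decay4.
have /cvg_ex[l hl] : cvgn (fun N => Lambda_sum alpha N (W 0%N)).
  by apply: is_cvg_Lambda_sum; case/andP: alpha02 => ? ?; rewrite !ltW.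
rewrite (cvg_lim _ hl)//.
have pi0 := @pi_gt0 R.
set B := 2 * A * (2 * pi) `^ alpha.
suff H N : 0 <= Lambda_sum alpha N (W 0%N) + B * harmonic N.
  have : (fun N => Lambda_sum alpha N (W 0%N) + B * harmonic N) @ \oo --> l + B * 0.
    apply: cvgD => //; apply: cvgM; first exact: cvg_cst.
    exact: cvg_harmonic.
  by rewrite mulr0 addr0 => /cvgr_to_ge; apply; exists 0%N.
have J0 := integral_levy_gt0 alpha; have Jy := integral_levy_fin alpha02.
have Jf : (\int[lebesgue_measure]_s (levy alpha 1 s)%:E)%E \is a fin_num.
  by rewrite ge0_fin_numE// ltW.
set J := fine (\int[lebesgue_measure]_s (levy alpha 1 s)%:E)%E.
have J_gt0 : 0 < J by rewrite fine_gt0// J0.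
have levyJ a : 0 < a -> \int[lebesgue_measure]_s levy alpha a s = a `^ alpha * J.
  by move=> a0; rewrite /Rintegral integral_levy_scale// fineM.
have levyI a : 0 < a -> lebesgue_measure.-integrable setT (EFin \o levy alpha a).
  move=> a0; apply/integrableP; split; first exact: measurable_levy.
  under eq_integral do rewrite /= ger0_norm ?levy_ge0//.
  by rewrite integral_levy_scale// -(fineK Jf) -EFinM ltry.
pose T n s := \sum_(k < n) 2 * cos_coef k.+1 (W 0%N) * levy alpha (2 * pi * k.+1%:R) s.
have TE n : lebesgue_measure.-integrable setT (EFin \o T n) /\
    \int[lebesgue_measure]_s T n s = Lambda_sum alpha n (W 0%N) * J.
  elim: n => [|n [IH1 IH2]].
    have -> : T 0%N = fun=> 0 by apply/funext => s; rewrite /T big_ord0.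
    rewrite /Lambda_sum big_ord0 mul0r; split; first exact: integrable0.
    by rewrite /Rintegral integral0.
  pose h s := 2 * cos_coef n.+1 (W 0%N) * levy alpha (2 * pi * n.+1%:R) s.
  have -> : T n.+1 = fun s => T n s + h s.
    by apply/funext => s; rewrite /T big_ord_recr.
  have a0 : 0 < 2 * pi * n.+1%:R :> R by rewrite !mulr_gt0.
  have hi : lebesgue_measure.-integrable setT (EFin \o h).
    rewrite (_ : EFin \o h = fun s => ((2 * cos_coef n.+1 (W 0%N))%:E * (levy alpha (2 * pi * n.+1%:R) s)%:E)%E)//.
    by apply: integrableZl => //; exact: levyI.
  split; first exact: (@integrableD _ _ _ lebesgue_measure _ measurableT _ _ IH1 hi).
  rewrite RintegralD// IH2 RintegralZl//; last exact: levyI.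
  by rewrite levyJ// /Lambda_sum big_ord_recr/=; ring.
have [Ti TJ] := TE N.
have c0 : 0 < 2 * pi :> R by rewrite mulr_gt0.
rewrite -(pmulr_lge0 _ J_gt0) mulrDl -TJ.
rewrite (_ : B * _ * J = \int[lebesgue_measure]_s (2 * A / N.+1%:R * levy alpha (2 * pi) s)); last first.
  by rewrite RintegralZl// ?levyJ// /B /harmonic/=; [ring|exact: levyI].
rewrite -RintegralD//; last first.
  rewrite (_ : EFin \o _ = fun s => ((2 * A / N.+1%:R)%:E * (levy alpha (2 * pi) s)%:E)%E)//.
  by apply: integrableZl => //; exact: levyI.
apply: Rintegral_ge0 => s _.
have := mulr_ge0 (sym_diff_sum_ge N (expR s) WA) (expR_ge0 (- alpha * s)).
rewrite mulrDl mulr_suml => H; apply: (le_trans H); rewrite le_eqVlt; apply/orP; left.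
apply/eqP; congr (_ + _); last by rewrite /levy mulrA.
by apply: eq_bigr => k _; rewrite /levy mulrA.
Qed.

End chain.

End Lambda.

(** * The one-sided Lipschitz estimate *)

Section MaxPrinciple.
Context {R : realType}.
Implicit Types (v w : R -> R) (k n N : nat) (x y z s alpha : R).

(** The difference z |-> V (z + y) - V (z + x) has its maximum at 0, and [Lambda] of
    it at 0 is the difference of the two sides. *)
Lemma Lambda_le (V : nat -> R -> R) alpha x y : 0 < alpha < 2 ->
  (forall j z, is_derive z (1 : R) (V j) (V j.+1 z)) -> periodic (V 0%N) 1 ->
  (forall z, V 0%N (z + y) - V 0%N (z + x) <= V 0%N y - V 0%N x) ->
  Lambda alpha (V 0%N) x <= Lambda alpha (V 0%N) y.
Proof.
move=> al02 dV pV Vmax.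
have al0 : alpha != 0 by case/andP: al02 => ? _; rewrite gt_eqF.
have al02' : 0 <= alpha <= 2 by case/andP: al02 => ? ?; rewrite !ltW.
have cV := is_derive_continuous (dV 0%N).
have dS c j z : is_derive z (1 : R) (fun z => V j (z + c)) (V j.+1 (z + c)).
  exact: is_derive_shift.
have pS c : periodic (fun z => V 0%N (z + c)) 1 by move=> z; rewrite addrAC pV.
pose W j z := V j (z + y) - V j (z + x).
have dW j z : is_derive z (1 : R) (W j) (W j.+1 z).
  by have h1 := dS y j z; have h2 := dS x j z; apply: is_derive_eq.
have pW : periodic (W 0%N) 1 by move=> z; rewrite /W (pS y z) (pS x z).
rewrite !LambdaE// -subr_ge0 -limB.
- rewrite (_ : _ - _ = fun N => Lambda_sum alpha N (W 0%N)).
    by apply: lim_Lambda_sum_ge0 => // z; rewrite /W !add0r.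
  apply/funext => N; transitivity (Lambda_sum alpha N (fun z => V 0%N (z + y)) -
    Lambda_sum alpha N (fun z => V 0%N (z + x))); first by [].
  rewrite /Lambda_sum -sumrB; apply: eq_bigr => k _.
  by rewrite -mulrBr -cos_coefB//; exact: continuous_shift.
- exact: (@is_cvg_Lambda_sum _ (fun j z => V j (z + y)) (dS y) (pS y)).
- exact: (@is_cvg_Lambda_sum _ (fun j z => V j (z + x)) (dS x) (pS x)).
Qed.

Lemma continuous_pair (T : topologicalType) (a b : T -> R) :
  continuous a -> continuous b -> continuous (fun q => (a q, b q)).
Proof.
move=> ca cb q.
exact: (@cvg_pair _ _ _ (nbhs q) (nbhs (a q)) (nbhs (b q)) _ _ _ a b (ca q) (cb q)).
Qed.

(** Composing with the absolute value of the time extends a function on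
    [0, +oo[ x R to a continuous function on the whole plane. *)
Lemma continuous_abs_time (g : R * R -> R) :
  {within [set q : R * R | 0 <= q.1], continuous g} ->
  continuous (fun q : R * R => g (`|q.1|, q.2)).
Proof.
move=> /subspace_continuousP cg q.
have c : (fun q : R * R => (`|q.1|, q.2)) @ q --> (`|q.1|, q.2).
  apply: (@continuous_pair _ (fun q : R * R => `|q.1|) snd).
  - by move=> p; apply: cvg_norm; exact: cvg_fst.
  - by move=> p; exact: cvg_snd.
apply: (cvg_trans _ (cg (`|q.1|, q.2) (normr_ge0 _))).
move=> A /= gA.
have := c _ gA; rewrite /= !nbhs_filterE /=.
by apply: filterS => -[a b] /=; apply; exact: normr_ge0.
Qed.

Section solution.
Variables (alpha nu : R) (f : R -> R) (u0 : R -> R) (u : R -> R -> R).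
Hypotheses (alpha12 : 1 < alpha < 2) (nu_gt0 : 0 < nu).
Hypotheses (sf : smooth f) (f2 : forall x, 0 <= f^`(2) x).
Hypothesis (su : solution alpha nu f u0 u).

Lemma solution_derivs : exists U : nat -> nat -> R -> R -> R,
    [/\ forall t, 0 <= t -> u t = U 0%N 0%N t,
        forall i j (t x : R), 0 <= t -> is_derive x (1 : R) (U i j t) (U i j.+1 t x)
      & forall i j, continuous (fun q : R * R => U i j `|q.1| q.2)].
Proof.
case: su => -[U [U00 Ux Ut Uc]] _ _ _ _; exists U; split.
- by move=> t t0; apply/funext => x; rewrite U00.
- exact: Ux.
- by move=> i j; exact: (continuous_abs_time (Uc i j)).
Qed.

Lemma flux_derive_nondecreasing : {homo f^`() : x y / x <= y}.
Proof.
move=> x y xy.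
have d1 z : derivable f^`() z 1 by exact: (@sf 1%N z).
have cf : continuous f^`().
  by move=> z; apply/differentiable_continuous/derivable1_diffP.
have [->|xy'] := eqVneq x y; first by [].
have xy2 : x < y by rewrite lt_neqAle xy'.
have [c _ e] := MVT xy2 (fun z _ => derivableP (d1 z)) (continuous_subspaceT cf).
rewrite -subr_ge0 e mulr_ge0// ?subr_ge0//.
by have := f2 c; rewrite /derive1n /= derive1E.
Qed.

(** At positive times the one-sided filter in [dt] is coarser than the left
    neighbourhood filter, which is the one the maximum principle uses. *)
Lemma dt_cvg t x : 0 < t ->
  (fun s => (u s x - u t x) / (s - t)) @ t^'- --> dt u t x.
Proof.
move=> t0; case: su => -[U [U00 Ux Ut Uc]] _ _ _ _.
have c : (fun s => (u s x - u t x) / (s - t)) @ within [set s | 0 <= s] t^' --> U 1%N 0%N t x.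
  apply: cvg_trans (Ut 0%N 0%N t x (ltW t0)); apply: near_eq_cvg.
  apply: filterS (withinT _ _) => s /= s0.
  by rewrite -!U00// ltW.
have c2 := cvgP _ c.
have c3 : t^'- `=>` within [set s | 0 <= s] t^'.
  move=> A tA.
  have p : \forall s \near t, 0 < s by exact: lt_nbhsr.
  apply: (@filterS2 _ (nbhs t) _ _ _ _ _ tA p) => s /= H s0 st.
  by apply: H; rewrite ?lt_eqF//= ltW.
apply: cvg_trans c2; exact: cvg_app.
Qed.

Lemma dt_equation t x : 0 <= t ->
  dt u t x = - (f^`()%classic (u t x) * (u t)^`()%classic x) - nu * Lambda alpha (u t) x.
Proof.
move=> t0; have [U [Uu Ux Uc]] := solution_derivs.
case: su => _ _ _ _ /(_ t x t0); rewrite derive1_comp.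
- by move=> /eqP; rewrite -addrA addr_eq0 => /eqP ->; rewrite opprD.
- by rewrite Uu//; have [] := Ux 0%N 0%N t x t0.
- exact: (@sf 0%N _).
Qed.

(** The contradiction at a maximum (t, x, y).  Maximality in time gives
    u_t(y) - u_t(x) >= eta > 0, whereas the equation, with equal slopes B >= 0 and
    u(x) <= u(y), makes this difference nonpositive. *)
Lemma max_principle_step (B eta : R) t x y : 0 <= B -> 0 < eta -> 0 < t ->
  u t x <= u t y ->
  (u t)^`()%classic x = B -> (u t)^`()%classic y = B ->
  (forall z, u t (z + y) - u t (z + x) <= u t y - u t x) ->
  (forall s, 0 <= s <= t ->
    u s y - u s x - eta * s <= u t y - u t x - eta * t) -> False.
Proof.
move=> B0 eta0 t0 uxy ux uy zmax smax.
have t0' := ltW t0.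
have al02 : 0 < alpha < 2 by move: alpha12 => /andP[? ?]; apply/andP; split; lra.
have [U [Uu Ux Uc]] := solution_derivs.
have per : periodic (u t) 1 by case: su => _ + _ _ _; apply.
have LL : Lambda alpha (u t) x <= Lambda alpha (u t) y.
  have e := Uu t t0'; rewrite e in per zmax *.
  by apply: (@Lambda_le (U 0%N ^~ t)) => // j z; exact: Ux.
have F : f^`()%classic (u t x) <= f^`()%classic (u t y) by exact: flux_derive_nondecreasing.
have : eta <= dt u t y - dt u t x.
  have c : (fun s => (u s y - u t y) / (s - t) - (u s x - u t x) / (s - t)) @ t^'- -->
      dt u t y - dt u t x.
    by apply: cvgB; exact: dt_cvg.
  apply: (cvgr_to_ge c).
  near=> s.
  have st : s < t by near: s; exact: nbhs_left_lt.
  have s0 : 0 <= s by near: s; exact: nbhs_left_ge.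
  have := smax s; rewrite s0 ltW// => /(_ isT) H.
  rewrite -mulrBl ler_ndivlMr ?subr_lt0//; lra.
rewrite !dt_equation// ux uy.
have : B * f^`()%classic (u t x) <= B * f^`()%classic (u t y) by rewrite ler_wpM2l.
have : nu * Lambda alpha (u t) x <= nu * Lambda alpha (u t) y by rewrite ler_wpM2l// ltW.
lra.
Unshelve. all: by end_near.
Qed.

(** By periodicity a violation can be moved to x in [0, 1] and h = y - x in [0, 1].
    The penalty eta t is small enough to leave a positive maximum of
    u(t, x + h) - u(t, x) - B h - eta t; it cannot lie at t = 0, h = 0 or h = 1,
    so the derivatives in h and in x vanish there. *)
Lemma one_sided_lipschitz (B : R) : 0 <= B ->
  (forall x y, x <= y -> u0 y - u0 x <= B * (y - x)) ->
  forall t x y, 0 <= t -> x <= y -> u t y - u t x <= B * (y - x).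
Proof.
move=> B0 u0B t x y t0 xy.
have [U [Uu Ux Uc]] := solution_derivs.
have per s : 0 <= s -> periodic (u s) 1 by case: su => _ + _ _ _; apply.
have U0 z : u 0 z = u0 z by case: su.
rewrite leNgt; apply/negP => neg.
pose phi s z h := u s (z + h) - u s z - B * h.
have [x1 [h1 [x101 h101 phi1]]] : exists x1 h1,
    [/\ 0 <= x1 <= 1, 0 <= h1 <= 1 & 0 < phi t x1 h1].
  exists (x - (Num.floor x)%:~R), (y - x - (Num.floor (y - x))%:~R).
  have /andP[l r] := floor_itv x; have /andP[l' r'] := floor_itv (y - x).
  split; first by rewrite subr_ge0 l/= lerBlDl -intrD1 ltW.
    by rewrite subr_ge0 l'/= lerBlDl -intrD1 ltW.
  rewrite /phi; have pt := periodic_intr (per t t0).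
  have -> : u t (x - (Num.floor x)%:~R) = u t x.
    by rewrite -[LHS](pt (Num.floor x)) subrK.
  have -> : u t (x - (Num.floor x)%:~R + (y - x - (Num.floor (y - x))%:~R)) = u t y.
    rewrite -[LHS](pt (Num.floor x + Num.floor (y - x))); congr (u t _).
    by rewrite intrD; ring.
  rewrite subr_gt0; apply: le_lt_trans neg; rewrite ler_wpM2l// gerBl ler0z.
  by rewrite floor_ge0 subr_ge0.
pose eta := phi t x1 h1 / (2 * (t + 1)).
have eta0 : 0 < eta by rewrite divr_gt0// mulr_gt0//; lra.
pose Phi (q : R * R * R) := U 0%N 0%N `|q.1.1| (q.1.2 + q.2) - U 0%N 0%N `|q.1.1| q.1.2
  - B * q.2 - eta * q.1.1.
have PhiE s z h : 0 <= s -> Phi (s, z, h) = phi s z h - eta * s.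
  by move=> s0; rewrite /Phi/= ger0_norm// -!Uu.
have c1 : continuous (fun q : R * R * R => q.1.1).
  by move=> q; apply: (@continuous_comp _ _ _ fst fst); exact: cvg_fst.
have c2 : continuous (fun q : R * R * R => q.1.2).
  by move=> q; apply: (@continuous_comp _ _ _ fst snd); [exact: cvg_fst|exact: cvg_snd].
have c3 : continuous (fun q : R * R * R => q.2).
  by move=> q; exact: cvg_snd.
have cPhi : continuous Phi.
  move=> q; rewrite /Phi; apply: cvgB; [apply: cvgB; [apply: cvgB|]|].
  - apply: (@continuous_comp _ _ _ (fun q : R * R * R => (q.1.1, q.1.2 + q.2))
      (fun q : R * R => U 0%N 0%N `|q.1| q.2)); last exact: Uc.
    apply: continuous_pair => // p; apply: cvgD; [exact: c2|exact: c3].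
  - apply: (@continuous_comp _ _ _ (fun q : R * R * R => (q.1.1, q.1.2))
      (fun q : R * R => U 0%N 0%N `|q.1| q.2)); last exact: Uc.
    exact: continuous_pair.
  - by apply: cvgM; [exact: cvg_cst|exact: c3].
  - by apply: cvgM; [exact: cvg_cst|exact: c1].
pose K : set (R * R * R) := (`[0, t] `*` `[0, 1]) `*` `[0, 1].
have K0 : K (t, x1, h1) by rewrite /K /= !in_itv/= t0 lexx.
have cK : compact K.
  by apply: compact_setX; [apply: compact_setX|]; exact: segment_compact.
(* a maximum over the compact set; Phi is defined with the absolute value of the
   time, hence continuous everywhere *)
have [s [z [h [Ks Pmax]]]] : exists (s z h : R), K (s, z, h) /\
    forall q, K q -> Phi q <= Phi (s, z, h).
  have [[[s z] h]] := compact_EVT_max (ex_intro _ _ K0) cK (continuous_subspaceT cPhi).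
  rewrite inE => Ks Pmax; exists s, z, h; split => // q Kq.
  by apply: Pmax; rewrite inE.
move: Ks; rewrite /K/= !in_itv/= => -[[/andP[s0 st] z01] h01].
have {}Pmax (s' z' h' : R) : 0 <= s' <= t -> 0 <= z' <= 1 -> 0 <= h' <= 1 ->
    phi s' z' h' - eta * s' <= phi s z h - eta * s.
  move=> s't z'1 h'1; rewrite -!PhiE//; last by case/andP: s't.
  by apply: Pmax; rewrite /K/= !in_itv/=.
have pos : 0 < phi s z h - eta * s.
  apply: (lt_le_trans _ (Pmax t x1 h1 _ x101 h101)); last by rewrite t0 lexx.
  rewrite subr_gt0 /eta mulrAC ltr_pdivrMr ?ltr_pM2l//; lra.
have phi0 : 0 < phi s z h by have := mulr_ge0 (ltW eta0) s0; lra.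
have zmax z' h' : 0 <= h' <= 1 -> phi s z' h' <= phi s z h.
  move=> h'1; have -> : phi s z' h' = phi s (z' - (Num.floor z')%:~R) h'.
    rewrite /phi -[in RHS](periodic_intr (per s s0) (Num.floor z') (_ - _)) subrK.
    congr (_ - _ - _); rewrite -[RHS](periodic_intr (per s s0) (Num.floor z')).
    by congr (u s _); ring.
  have /andP[l r] := floor_itv z'.
  have := Pmax s (z' - (Num.floor z')%:~R) h'; rewrite s0 st h'1 subr_ge0 l lerBlDl -intrD1 (ltW r).
  by move=> /(_ isT isT isT); rewrite lerD2r.
have s_gt0 : 0 < s.
  rewrite lt_neqAle s0 andbT; apply/eqP => s00; move: phi0.
  rewrite -s00 /phi !U0 subr_gt0 ltNge.
  have := u0B z (z + h); rewrite lerDl addrAC subrr add0r; case/andP: h01 => -> _.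
  by move=> /(_ isT) ->.
have h_gt0 : 0 < h.
  rewrite lt_neqAle; case/andP: h01 => -> _; rewrite andbT; apply/eqP => h00; move: phi0.
  by rewrite -h00 /phi addr0 subrr mulr0 subrr ltxx.
have h_lt1 : h < 1.
  rewrite lt_neqAle; case/andP: h01 => _ ->; rewrite andbT; apply/eqP => h00; move: phi0.
  by rewrite h00 /phi per// subrr sub0r mulr1 oppr_gt0 ltNge B0.
have us (w : R) : is_derive w (1 : R) (u s) (U 0%N 1%N s w).
  by rewrite Uu//; exact: Ux.
have ush c (w : R) : is_derive w (1 : R) (fun w : R => u s (w + c)) (U 0%N 1%N s (w + c)).
  exact: is_derive_shift.
have usE (w : R) : (u s)^`()%classic w = U 0%N 1%N s w by rewrite derive1E; have [] := us w.
have dh : U 0%N 1%N s (z + h) = B.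
  have d (w : R) : is_derive w (1 : R) (fun w : R => u s (w + z) - u s z - B * w) (U 0%N 1%N s (w + z) - B).
    by have h2 := ush z w; apply: is_derive_eq; rewrite subr0 /GRing.scale/= mulr1.
  have : is_derive h (1 : R) (fun w : R => u s (w + z) - u s z - B * w) 0.
    apply: (@derive1_at_max _ _ 0 1) => //.
    - by rewrite in_itv/= h_gt0.
    - move=> w; rewrite in_itv/= => /andP[w0 w1].
      by have := zmax z w; rewrite (ltW w0) (ltW w1) => /(_ isT); rewrite /phi !(addrC z).
  case=> _; have [_ ->] := d h => /eqP; rewrite subr_eq0 addrC => /eqP.
  by [].
have dz : U 0%N 1%N s z = B.
  have d (w : R) : is_derive w (1 : R) (fun w : R => u s (w + h) - u s w) (U 0%N 1%N s (w + h) - U 0%N 1%N s w).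
    by have h2 := ush h w; have h3 := us w; apply: is_derive_eq.
  have : is_derive z (1 : R) (fun w : R => u s (w + h) - u s w) 0.
    apply: (@derive1_at_max _ _ (z - 1) (z + 1)).
    - lra.
    - by move=> w _; have [] := d w.
    - by rewrite in_itv/=; lra.
    - by move=> w _; have := zmax w h; rewrite /phi lerD2r; apply.
  case=> _; have [_ ->] := d z => /eqP; rewrite subr_eq0 => /eqP <-.
  by [].
apply: (@max_principle_step B eta s z (z + h)) => //.
- have := mulr_ge0 B0 (ltW h_gt0); move: phi0; rewrite /phi; lra.
- by rewrite usE.
- by rewrite usE.
- move=> w; have := zmax (w + z) h; rewrite /phi lerD2r addrA; apply.
  by rewrite !ltW.
- move=> r /andP[r0 rs].
  have := Pmax r z h; rewrite r0 (le_trans rs st) z01 h01 => /(_ isT isT isT).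
  rewrite /phi; lra.
Qed.

End solution.
End MaxPrinciple.

(** * Sup norms and cliffs *)

Section Norms.
Context {R : realType}.
Implicit Types (v : R -> R) (x y z : R).

(** For a continuous function the essential supremum over [0, 1] is an attained
    maximum, since a larger value would persist on an interval of positive
    measure. *)
Lemma lpnorm_infty v : continuous v ->
  exists x1, [/\ 0 <= x1 <= 1, lpnorm +oo v = `|v x1|
    & forall x, 0 <= x <= 1 -> `|v x| <= `|v x1|].
Proof.
move=> cv.
have cn : continuous (fun x => `|v x|).
  by move=> x; apply: continuous_comp; [exact: cv|exact: norm_continuous].
have [x1 x101 xM] := EVT_max (@ler01 R) (continuous_subspaceT cn).
have {}xM x : 0 <= x <= 1 -> `|v x| <= `|v x1| by move=> x01; apply: xM; rewrite in_itv.
have {}x101 : 0 <= x1 <= 1 by move: x101; rewrite in_itv.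
exists x1; split => //.
suff E : ('N[lebesgue_measure]_+oo[(EFin \o v) \_ `[0%R, 1%R]])%E = `|v x1|%:E.
  by rewrite /lpnorm E.
have muT : (0 < lebesgue_measure [set: R])%E by rewrite -set_itvNyy lebesgue_measure_itv/= ltry.
rewrite unlock muT.
set g := abse \o _.
have gE x : 0 <= x <= 1 -> g x = `|v x|%:E.
  by move=> x01; rewrite /g /= patchE mem_set//= in_itv.
have g0 x : ~ (0 <= x <= 1) -> g x = 0%E.
  by move=> x01; rewrite /g /= patchE memNset ?abse0//= in_itv.
apply/eqP; rewrite eq_le; apply/andP; split.
  apply/ess_supP; apply: aeW => x.
  have [x01|x01] := boolP (0 <= x <= 1); first by rewrite gE// lee_fin xM.
  by rewrite g0 ?lee_fin//; exact/negP.
rewrite leNgt; apply/negP => H.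
have [M [MH HM]] : exists M : R, (ess_sup lebesgue_measure g <= M%:E)%E /\ M < `|v x1|.
  move: H; case: (ess_sup _ _) => [r| |]//=.
    by rewrite lte_fin => rv; exists r.
  by move=> _; exists (`|v x1| - 1); rewrite leNye ltrBlDr ltrDl.
have := cvgr_gt _ (cn x1) M HM => -[e /= e0 eM].
pose a := Num.max 0 (x1 - e); pose b := Num.min 1 (x1 + e).
have /andP[x10 x11] := x101.
have ab : a < b.
  by rewrite /a /b gt_max !lt_min; apply/andP; split; apply/andP; split; lra.
have sub : `]a, b[ `<=` ~` [set x | (g x <= ess_sup lebesgue_measure g)%E].
  move=> x /=; rewrite in_itv/= /a /b gt_max lt_min => /andP[/andP[x0 xe] /andP[x1' xe']].
  apply/negP; rewrite -ltNge (le_lt_trans MH)// gE; last by rewrite !ltW.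
  by rewrite lte_fin; apply: eM; rewrite /= ltr_distl; apply/andP; split; lra.
have [A [mA A0 sA]] := ess_sup_ge lebesgue_measure g.
have : (lebesgue_measure (`]a, b[ : set R) <= 0)%E.
  by rewrite -A0; apply: le_measure; rewrite ?inE//; exact: subset_trans sub sA.
rewrite lebesgue_measure_itv/= lte_fin ab -EFinB lee_fin subr_le0.
by rewrite leNgt ab.
Qed.

Lemma le_lpnorm_infty v x : continuous v -> periodic v 1 -> `|v x| <= lpnorm +oo v.
Proof.
move=> cv pv; have [x1 [_ -> H]] := lpnorm_infty cv.
by have [y y01 ->] := periodic_reduce x pv; exact: H.
Qed.

Lemma MVT_le v v1 (B a b : R) : a <= b -> (forall x, is_derive x (1 : R) v (v1 x)) ->
  (forall x, a <= x <= b -> v1 x <= B) -> v b - v a <= B * (b - a).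
Proof.
rewrite le_eqVlt => /predU1P[->|ab] dv vB; first by rewrite !subrr mulr0.
have [c] := MVT ab (fun x _ => dv x) (continuous_subspaceT (is_derive_continuous dv)).
rewrite in_itv/= => /andP[ac cb] ->; rewrite ler_wpM2r//.
  by rewrite subr_ge0 ltW.
by apply: vB; rewrite (ltW ac) (ltW cb).
Qed.

(** With N = nu^(-beta): where |v1| >= N / K the sign must be negative, because
    N / K >= 6 K > K.  On a window of half-width d = 1 / (4 K^2 N) around this point
    the slope stays below - 3 N / (4 K), so a segment of length d inside the window
    loses 3 / (16 K^3).  The rest of [x, x + l] regains at most
    K l <= 1 / (20 K^3), and 3/16 - 1/20 >= 1/10. *)
Lemma cliff_drop v v1 v2 (K N l : R) :
  (forall x, is_derive x (1 : R) v (v1 x)) ->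
  (forall x, is_derive x (1 : R) v1 (v2 x)) ->
  (forall x, v1 x <= K) -> (forall x, `|v2 x| <= K * N ^+ 2) ->
  (exists x1, K^-1 * N <= `|v1 x1|) ->
  1 < K -> 6 * K ^+ 2 <= N -> 4^-1 * K ^- 2 / N < l -> l <= 20^-1 * K ^- 4 ->
  exists a, forall x, a <= x <= a + l -> 10^-1 * K ^- 3 <= v x - v (x + l).
Proof.
move=> dv dv1 v1K v2K [x1 hx1] K1 KN dl lK.
have K0 : 0 < K by lra.
have Kn0 : K != 0 by rewrite gt_eqF.
have N0 : 0 < N by apply: lt_le_trans KN; rewrite mulr_gt0// exprn_gt0.
have Nn0 : N != 0 by rewrite gt_eqF.
set d := 4^-1 * K ^- 2 / N.
have d0 : 0 < d by rewrite /d !mulr_gt0 ?invr_gt0 ?exprn_gt0.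
have KN2 : 6 * K <= K^-1 * N.
  by rewrite ler_pdivlMl// mulrCA -expr2.
have neg1 : v1 x1 <= - (K^-1 * N).
  move: hx1; have := v1K x1; case: (ler0P (v1 x1)) => ? ? ?; lra.
(* the slope varies by at most K N^2 d = N / (4 K) over the window *)
have steep y : `|y - x1| <= d -> v1 y <= - (3 / 4 * (K^-1 * N)).
  move=> yd.
  have h : `|v1 y - v1 x1| <= K * N ^+ 2 * d.
    have KN20 : 0 <= K * N ^+ 2 by rewrite mulr_ge0 ?sqr_ge0// ltW.
    apply: le_trans (ler_wpM2l KN20 yd).
    by apply: (norm_MVT_le dv1) => z _; exact: v2K.
  have e : K * N ^+ 2 * d = 4^-1 * (K^-1 * N).
    by rewrite /d; field; rewrite Kn0 Nn0.
  rewrite e in h; have := ler_norm (v1 y - v1 x1); lra.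
have drop p : x1 - d <= p <= x1 -> 3 / 16 * K ^- 3 <= v p - v (p + d).
  move=> /andP[p1 p2].
  have pd : p <= p + d by lra.
  have : v (p + d) - v p <= - (3 / 4 * (K^-1 * N)) * (p + d - p).
    apply: (MVT_le pd dv) => z /andP[z1 z2]; apply: steep.
    by rewrite ler_distl; apply/andP; split; lra.
  have -> : - (3 / 4 * (K^-1 * N)) * (p + d - p) = - (3 / 16 * K^-3).
    by rewrite /d; field; rewrite Kn0 Nn0.
  lra.
have rise p q : p <= q -> v q - v p <= K * (q - p).
  by move=> pq; apply: (MVT_le pq dv) => z _; exact: v1K.
have Kl : K * l <= 20^-1 * K^-3.
  rewrite (le_trans (ler_wpM2l (ltW K0) lK))// le_eqVlt; apply/orP; left; apply/eqP.
  by field.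
have K30 : 0 < K^-3 by rewrite invr_gt0 exprn_gt0.
exists (x1 - l) => x /andP[xl xr].
have rx : x <= x1 by lra.
(* since d < l, one of [x, x + d] and [x1 - d, x1] lies in both [x, x + l] and the
   window *)
have [h|h] := leP (x1 - d) x.
  have h1 := drop x; rewrite h rx in h1.
  have := h1 isT; have := rise (x + d) (x + l); rewrite lerD2l ltW// => /(_ isT).
  have : K * (x + l - (x + d)) <= K * l by rewrite ler_pM2l//; lra.
  move=> ? ? ?; lra.
have := drop (x1 - d); rewrite lexx gerBl (ltW d0) => /(_ isT).
have := rise x (x1 - d) (ltW h).
have h3 : x1 - d + d <= x + l by lra.
have := rise _ _ h3.
have : K * (x1 - d - x) + K * (x + l - (x1 - d + d)) <= K * l.
  by rewrite -mulrDr ler_pM2l//; lra.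
move=> ? ? ? ?; lra.
Qed.

End Norms.

(** * Moments of increments *)

Section Increments.
Context {R : realType}.
Implicit Types (v : R -> R) (x y z : R).

(** Around the circle one can always reach z from y by moving to the right by at most
    1, so the oscillation is at most D; a mean-zero function is then bounded by
    its oscillation. *)
Lemma sup_norm_of_lipschitz v (D : R) : 0 <= D -> continuous v -> periodic v 1 -> mean v = 0 ->
  (forall x y, x <= y -> v y - v x <= D * (y - x)) -> forall x, `|v x| <= D.
Proof.
move=> D0 cv pv v0 vD x.
have osc y z : v z - v y <= D.
  have pz := periodic_intr pv (Num.floor (z - y)) (z - (Num.floor (z - y))%:~R).
  rewrite subrK in pz; rewrite pz.
  have /andP[l r] := floor_itv (z - y).
  rewrite intrD1 in r.
  apply: (@le_trans _ _ (D * (z - (Num.floor (z - y))%:~R - y))); first by apply: vD; lra.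
  by rewrite -[leRHS]mulr1 ler_wpM2l//; lra.
have cc (a : R) : continuous (fun _ : R => a) by move=> y; exact: cvg_cst.
rewrite ler_norml; apply/andP; split.
- rewrite lerNl -subr_ge0 opprK -[leRHS](mean_cst (D + v x)) -v0 le_mean// => y _.
  by have := osc x y; lra.
- rewrite -subr_le0 -[leLHS](mean_cst (v x - D)) -v0 le_mean// => y _.
  by have := osc y x; lra.
Qed.

Lemma continuous_incr v l n : continuous v -> continuous (fun x => `|v (x + l) - v x| ^+ n).
Proof.
move=> cv x; apply: (@continuous_comp _ _ _ (fun x => `|v (x + l) - v x|) (fun y => y ^+ n)).
  by apply: cvg_norm; apply: cvgB; [exact: continuous_shift|exact: cv].
exact: exprn_continuous.
Qed.

(** An increment d <= D l satisfies |d| <= 2 D l - d, and d has mean zero. *)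
Lemma mean_incr_le v (D l : R) n : 0 <= D -> 0 <= l ->
  continuous v -> periodic v 1 -> mean v = 0 ->
  (forall x y, x <= y -> v y - v x <= D * (y - x)) ->
  mean (fun x => `|v (x + l) - v x| ^+ n.+1) <= (2 * D) ^+ n.+1 * l.
Proof.
move=> D0 l0 cv pv v0 vD.
have vn := sup_norm_of_lipschitz D0 cv pv v0 vD.
have cs := continuous_shift (c := l) cv.
have cd : continuous (fun x => v (x + l) - v x).
  by move=> x; apply: cvgB; [exact: cs|exact: cv].
have cc : continuous (fun _ : R => 2 * D * l) by move=> y; exact: cvg_cst.
have c2 : continuous (fun x => 2 * D * l - (v (x + l) - v x)).
  by move=> x; apply: cvgB; [exact: cc|exact: cd].
apply: (@le_trans _ _ (mean (fun x => (2 * D) ^+ n * (2 * D * l - (v (x + l) - v x))))).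
  apply: le_mean; first exact: continuous_incr.
    by apply: continuousMr => // x; exact: cvg_cst.
  move=> x _; rewrite exprSr; apply: ler_pM => //.
    rewrite lerXn2r ?nnegrE ?mulr_ge0//.
    rewrite (le_trans (ler_normB _ _))//; have := vn x; have := vn (x + l); lra.
  have := vD x (x + l); rewrite lerDl addrAC subrr add0r => /(_ l0) h.
  have Dl : 0 <= D * l by rewrite mulr_ge0.
  by case: (ler0P (v (x + l) - v x)) => ?; lra.
rewrite meanZ// meanB// mean_cst meanB// mean_shift// subrr subr0.
by rewrite exprSr !mulrA.
Qed.

Lemma mean_incr_ge v (l c a : R) n : 0 <= l <= 1 -> 0 <= c -> continuous v -> periodic v 1 ->
  (forall x, a <= x <= a + l -> c <= v x - v (x + l)) ->
  l * c ^+ n <= mean (fun x => `|v (x + l) - v x| ^+ n).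
Proof.
move=> /andP[l0 l1] c0 cv pv vc.
set g := fun x => `|v (x + l) - v x| ^+ n.
have cg : continuous g by exact: continuous_incr.
have pg : periodic g 1 by move=> x; rewrite /g addrAC !pv.
rewrite -(mean_shift a cg pg).
have ca := continuous_shift (c := a) cg.
apply: (@le_trans _ _ (\int[lebesgue_measure]_(x in `[0, l]) g (x + a))).
  apply: (@le_trans _ _ (\int[lebesgue_measure]_(x in `[0, l]) (c ^+ n))).
    by rewrite Rintegral_cst_itv// subr0 mulrC.
  apply: le_Rintegral => //.
  - by apply: continuous_integrable_itv => x; exact: cvg_cst.
  - exact: continuous_integrable_itv.
  - move=> x; rewrite /= in_itv/= => /andP[x0 xl].
    rewrite lerXn2r ?nnegrE// distrC (le_trans (vc (x + a) _)) ?ler_norm//.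
    by apply/andP; split; lra.
have := @Rintegral_itvB _ (fun x => g (x + a)) (BLeft 0) (BRight 1) l
  (continuous_integrable_itv 0 1 ca).
rewrite !bnd_simp => /(_ l0 l1) /= e.
rewrite -subr_ge0 /mean e; apply: Rintegral_ge0 => x _.
exact: exprn_ge0.
Qed.

Lemma Rintegral_le_cst (A : R -> R) (a b M : R) : a < b -> {within `[a, b], continuous A} ->
  (forall t, a <= t <= b -> A t <= M) ->
  \int[lebesgue_measure]_(t in `[a, b]) A t <= M * (b - a).
Proof.
move=> ab cA AM.
have -> : M * (b - a) = \int[lebesgue_measure]_(t in `[a, b]) M.
  by rewrite Rintegral_cst_itv// ltW.
apply: le_Rintegral => //.
- by apply: continuous_compact_integrable => //; exact: segment_compact.
- by apply: continuous_integrable_itv => x; exact: cvg_cst.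
Qed.

(** L need not be measurable, so [lebesgue_measure L] is an outer measure; L is
    therefore replaced by the measurable superlevel set of A that contains it. *)
Lemma Rintegral_ge_outer (A : R -> R) (a b m c : R) (L : set R) :
  {within `[a, b], continuous A} -> (forall t, a <= t <= b -> 0 <= A t) ->
  0 <= m -> L `<=` `[a, b] -> (forall t, L t -> m <= A t) -> (c%:E <= lebesgue_measure L)%E ->
  m * c <= \int[lebesgue_measure]_(t in `[a, b]) A t.
Proof.
move=> cA A0 m0 Lab Lm cL.
have mA : measurable_fun (`[a, b] : set R) A.
  exact: subspace_continuous_measurable_fun.
have iA : lebesgue_measure.-integrable `[a, b] (EFin \o A).
  by apply: continuous_compact_integrable => //; exact: segment_compact.
pose B : set R := `[a, b] `&` A @^-1` `[m, +oo[.
have mB : measurable B by apply: mA.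
have LB : L `<=` B.
  by move=> t Lt; split; [exact: Lab|rewrite /= in_itv/= andbT; exact: Lm].
have cB : (c%:E <= lebesgue_measure B)%E by rewrite (le_trans cL)//; exact: le_mu_ext.
rewrite -lee_fin /Rintegral fineK; last exact: integrable_fin_num.
apply: (@le_trans _ _ (\int[lebesgue_measure]_(t in B) (A t)%:E)%E); last first.
  apply: ge0_subset_integral => //.
  - exact/measurable_EFinP.
  - exact: subIsetl.
apply: (@le_trans _ _ (\int[lebesgue_measure]_(t in B) m%:E)%E).
  by rewrite integral_cst// EFinM; apply: lee_wpmul2l => //; rewrite lee_fin.
apply: ge0_le_integral => //.
- apply/measurable_EFinP; apply: measurable_funS mA => //; exact: subIsetl.
- by move=> t [_]; rewrite /= in_itv/= andbT lee_fin.
Qed.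

End Increments.

(** * Structure functions of solutions *)

Section Assembly.
Context {R : realType}.
Implicit Types (v : R -> R) (x y z : R).

Lemma smooth_derivs v : smooth v -> forall j x, is_derive x (1 : R) v^`(j) (v^`(j.+1) x).
Proof.
move=> sv j x; rewrite (_ : v^`(j.+1) x = 'D_1 v^`(j) x); first exact/derivableP/sv.
by rewrite -derive1E.
Qed.

Lemma derive1n_derivs (V : nat -> R -> R) n :
  (forall j x, is_derive x (1 : R) (V j) (V j.+1 x)) -> (V 0%N)^`(n) = V n.
Proof.
move=> dV; elim: n => [//|n IH].
apply/funext => x; rewrite derive1nS IH derive1E.
by have [_ ->] := dV n x.
Qed.

(** D bounds |u0'|.  It cannot vanish, since a mean-zero function with zero slope is
    identically zero. *)
Lemma initial_lipschitz (D : R) u0 : initial_condition D u0 ->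
  0 < D /\ forall x y, x <= y -> u0 y - u0 x <= D * (y - x).
Proof.
case=> su pu mu [x0 ux0] DD.
have d0 := smooth_derivs su 0; have d1 := smooth_derivs su 1.
have c0 := is_derive_continuous d0; have c1 := is_derive_continuous d1.
have p1 := is_derive_periodic pu d0.
have DW : wnorm 1 +oo u0 <= D by rewrite -DD /D_of le_max lexx orbT.
have uD x : `|u0^`(1) x| <= D.
  by apply: le_trans DW; exact: le_lpnorm_infty.
have lip x y : x <= y -> u0 y - u0 x <= D * (y - x).
  move=> xy; apply: (MVT_le xy d0) => z _.
  exact: le_trans (ler_norm _) (uD z).
split => //.
have D0 : 0 <= D by apply: le_trans (uD 0).
rewrite lt_neqAle D0 andbT; apply/eqP => D00.
have := sup_norm_of_lipschitz D0 c0 pu mu lip x0.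
by rewrite -D00 normr_le0 (negbTE ux0).
Qed.

Lemma T1_gt0 (D Ct : R) : 0 < D -> 0 < Ct -> 0 < T1 D Ct.
Proof. by move=> D0 Ct0; rewrite /T1 !mulr_gt0// invr_gt0// exprn_gt0. Qed.

Lemma T1_lt_T2 (sigma D Ct : R) : 0 < D -> 0 < Ct -> T1 D Ct < T2 sigma D Ct.
Proof.
by move=> D0 Ct0; rewrite /T2 lt_max; apply/orP; left; have := T1_gt0 D0 Ct0; lra.
Qed.

Lemma ratio_bounds (a2 b2 a4 b4 S2 S4 l : R) :
  0 < a2 -> 0 < b2 -> 0 < a4 -> 0 < b4 -> 0 < l ->
  S2 <= b2 * l -> S4 <= b4 * l -> a2 * l <= S2 -> a4 * l <= S4 ->
  S4 / S2 ^+ 2 <= (b4 / a2 ^+ 2 + b2 ^+ 2 / a4) * l^-1 /\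
  l^-1 <= (b4 / a2 ^+ 2 + b2 ^+ 2 / a4) * (S4 / S2 ^+ 2).
Proof.
move=> a20 b20 a40 b40 l0 u2 u4 w2 w4.
have al2 : 0 < a2 * l by rewrite mulr_gt0.
have al4 : 0 < a4 * l by rewrite mulr_gt0.
have bl2 : 0 < b2 * l by rewrite mulr_gt0.
have S2_gt0 : 0 < S2 by exact: lt_le_trans w2.
have S4_gt0 : 0 < S4 by exact: lt_le_trans w4.
have c1 : 0 <= b4 / a2 ^+ 2 by rewrite ltW// divr_gt0// exprn_gt0.
have c2 : 0 <= b2 ^+ 2 / a4 by rewrite ltW// divr_gt0// exprn_gt0.
have F0 : 0 <= S4 / S2 ^+ 2 by rewrite ltW// divr_gt0// exprn_gt0.
have li0 : 0 <= l^-1 by rewrite invr_ge0 ltW.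
have := (gt_eqF a20, gt_eqF b20, gt_eqF a40, gt_eqF l0) => nz.
split.
- apply: (@le_trans _ _ (b4 / a2 ^+ 2 * l^-1)); last first.
    by rewrite ler_wpM2r// lerDl.
  rewrite (_ : b4 / a2 ^+ 2 * l^-1 = b4 * l / (a2 * l) ^+ 2); last first.
    by field; rewrite !nz.
  apply: ler_pM => //; first exact: ltW.
    by rewrite invr_ge0 exprn_ge0// ltW.
  by rewrite lef_pV2 ?posrE ?exprn_gt0// lerXn2r ?nnegrE// ltW.
- apply: (@le_trans _ _ (b2 ^+ 2 / a4 * (S4 / S2 ^+ 2))); last first.
    by rewrite ler_wpM2r// lerDr.
  rewrite (_ : l^-1 = b2 ^+ 2 / a4 * (a4 * l / (b2 * l) ^+ 2)); last first.
    by field; rewrite !nz.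
  apply: ler_wpM2l => //; apply: ler_pM => //; first exact: ltW.
    by rewrite invr_ge0 exprn_ge0// ltW.
  by rewrite lef_pV2 ?posrE ?exprn_gt0// lerXn2r ?nnegrE// ltW.
Qed.

Section bounds.
Variables (alpha nu sigma D Ct : R) (f : R -> R) (u0 : R -> R) (u : R -> R -> R).
Hypotheses (alpha12 : 1 < alpha < 2) (nu_gt0 : 0 < nu) (Ct0 : 0 < Ct).
Hypotheses (hf : admissible_flux f sigma) (hu0 : initial_condition D u0).
Hypothesis (su : solution alpha nu f u0 u).

Let D0 : 0 < D. Proof. by have [] := initial_lipschitz hu0. Qed.

Let T10 : 0 < T1 D Ct. Proof. exact: T1_gt0. Qed.

Let T12 : T1 D Ct < T2 sigma D Ct. Proof. exact: T1_lt_T2. Qed.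

Lemma solution_lipschitz t x y : 0 <= t -> x <= y -> u t y - u t x <= D * (y - x).
Proof.
have [sf s0 f2 _] := hf; have [_ lip] := initial_lipschitz hu0.
apply: (@one_sided_lipschitz _ alpha nu f u0 u) => //; last exact: ltW.
by move=> z; apply: le_trans (f2 z); exact: ltW.
Qed.

Lemma solution_regular t : 0 <= t -> exists V : nat -> R -> R,
  [/\ u t = V 0%N, forall j x, is_derive x (1 : R) (V j) (V j.+1 x) &
      forall j, periodic (V j) 1].
Proof.
move=> t0; have [U [Uu Ux Uc]] := solution_derivs su.
exists (U 0%N ^~ t).
have dV j x : is_derive x (1 : R) (U 0%N j t) (U 0%N j.+1 t x) by exact: Ux.
split => //; first exact: Uu.
elim=> [|j IH]; last exact: is_derive_periodic IH (dV j).
by rewrite -Uu//; case: su => _ + _ _ _; apply.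
Qed.

Definition incr_moment n l t : R := mean (fun x => `|u t (x + l) - u t x| ^+ n).

Lemma structure_functionE n l :
  structure_function sigma D Ct u n%:R l = (T2 sigma D Ct - T1 D Ct)^-1 *
    \int[lebesgue_measure]_(t in `[T1 D Ct, T2 sigma D Ct]) incr_moment n l t.
Proof.
rewrite /structure_function /time_average; congr (_ * _).
apply: eq_Rintegral => t _; apply: eq_Rintegral => x _.
by rewrite powR_mulrn.
Qed.

(** Only continuity in t at fixed x is used, with the bound 2 D on increments as
    domination. *)
Lemma incr_moment_continuous n l :
  {within `[T1 D Ct, T2 sigma D Ct], continuous (incr_moment n l)}.
Proof.
have [U [Uu Ux Uc]] := solution_derivs su.
pose g (t x : R) := `|U 0%N 0%N `|t| (x + l) - U 0%N 0%N `|t| x| ^+ n.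
have uU (t x : R) : U 0%N 0%N `|t| x = u `|t| x by rewrite Uu.
have cu t : 0 <= t -> continuous (u t).
  by move=> t0; have [V [-> dV _]] := solution_regular t0; exact: is_derive_continuous (dV 0%N).
have uD t x : 0 <= t -> `|u t x| <= D.
  move=> t0; apply: sup_norm_of_lipschitz; rewrite ?(ltW D0)//.
  - exact: cu.
  - by case: su => _ + _ _ _; apply.
  - by case: su => _ _ + _ _; apply.
  - by move=> a b; exact: solution_lipschitz.
have gE (t : R) : g t = fun x => `|u `|t| (x + l) - u `|t| x| ^+ n.
  by apply/funext => x; rewrite /g !uU.
have cUt x : continuous (fun t : R => U 0%N 0%N `|t| x).
  move=> t; apply: (@continuous_comp _ _ _ (fun t : R => (t, x)) (fun q : R * R => U 0%N 0%N `|q.1| q.2)); last exact: Uc.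
  by apply: continuous_pair => y; [exact: cvg_id|exact: cvg_cst].
have cg : {in `](T1 D Ct - 1), (T2 sigma D Ct + 1)[%classic, continuous (fun t => mean (g t))}.
  apply: (@continuity_under_integral _ _ _ lebesgue_measure g `[0, 1] (measurable_itv _) _ _ _ _ (fun=> (2 * D) ^+ n)).
  - move=> t _; apply: continuous_integrable_itv; rewrite gE.
    by apply: continuous_incr; exact: cu.
  - apply: aeW => x _ t _.
    apply: (@continuous_comp _ _ _ (fun t : R => `|U 0%N 0%N `|t| (x + l) - U 0%N 0%N `|t| x|) (fun y => y ^+ n)).
      by apply: cvg_norm; apply: cvgB; exact: cUt.
    exact: exprn_continuous.
  - by apply: continuous_integrable_itv => y; exact: cvg_cst.
  - move=> t _; apply: aeW => x _; rewrite gE ger0_norm ?exprn_ge0//.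
    have D0' := ltW D0.
    rewrite lerXn2r ?nnegrE ?mulr_ge0// (le_trans (ler_normB _ _))//.
    by have := uD `|t| x (normr_ge0 _); have := uD `|t| (x + l) (normr_ge0 _); lra.
apply: (@subspace_eq_continuous _ _ _ (fun t => mean (g t))).
  move=> t; rewrite inE/= in_itv/= => /andP[t1 _].
  have t0 : 0 <= t by rewrite (le_trans _ t1)// ltW.
  by rewrite gE /incr_moment ger0_norm.
apply: continuous_in_subspaceT => t; rewrite inE/= in_itv/= => /andP[t1 t2].
by apply: cg; rewrite inE/= in_itv/=; apply/andP; split; lra.
Qed.

Lemma structure_function_le n l : 0 <= l ->
  structure_function sigma D Ct u n.+1%:R l <= (2 * D) ^+ n.+1 * l.
Proof.
move=> l0; rewrite structure_functionE.
rewrite mulrC ler_pdivrMr ?subr_gt0//; apply: Rintegral_le_cst => //.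
  exact: incr_moment_continuous.
move=> t /andP[t1 _].
have t0 : 0 <= t by rewrite (le_trans _ t1)// ltW.
apply: mean_incr_le => //; first exact: ltW.
- by have [V [-> dV _]] := solution_regular t0; exact: is_derive_continuous (dV 0%N).
- by case: su => _ + _ _ _; apply.
- by case: su => _ _ + _ _; apply.
- by move=> x y; exact: solution_lipschitz.
Qed.

(** At each time of L_K the cliff lemma gives a drop of at least 1 / (10 K^3) over an
    interval of positions of length l. *)
Lemma structure_function_ge K C n l : 1 < K -> 0 < C -> nu <= nu0 alpha K ->
  (C%:E <= lebesgue_measure (L_set alpha sigma D Ct nu u K))%E ->
  C1 K * nu `^ beta alpha < l <= C2 K ->
  (T2 sigma D Ct - T1 D Ct)^-1 * (l * (10^-1 * K ^- 3) ^+ n * C) <=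
  structure_function sigma D Ct u n%:R l.
Proof.
move=> K1 C_gt0 hnu hL /andP[l1 l2].
have K0 : 0 < K by lra.
have beta0 : 0 < beta alpha by rewrite invr_gt0 subr_gt0; case/andP: alpha12.
have l0 : 0 < l.
  by apply: le_lt_trans l1; rewrite mulr_ge0 ?powR_ge0// /C1 mulr_ge0// invr_ge0 exprn_ge0// ltW.
have k0 : 0 <= 10^-1 * K ^- 3 by rewrite mulr_ge0// invr_ge0 exprn_ge0// ltW.
have l_le1 : l <= 1.
  have : K ^- 4 <= 1 by rewrite invf_le1 ?exprn_gt0// exprn_ege1// ltW.
  move: l2; rewrite /C2; lra.
have nub : nu `^ beta alpha <= 6^-1 * K ^- 2.
  have x0 : 0 <= 6^-1 * K ^- 2 by rewrite mulr_ge0// invr_ge0 exprn_ge0// ltW.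
  have := ge0_ler_powR (ltW beta0) _ _ hnu; rewrite !nnegrE => /(_ (ltW nu_gt0) (powR_ge0 _ _)).
  by rewrite /nu0 -powRrM mulVf ?gt_eqF// powRr1.
have nb0 : 0 < nu `^ beta alpha by rewrite powR_gt0.
set N := nu `^ (- beta alpha).
have NE : N = (nu `^ beta alpha)^-1 by rewrite /N powRN.
have N6 : 6 * K ^+ 2 <= N.
  rewrite NE -[leLHS]invrK lef_pV2 ?posrE//; last by rewrite invr_gt0 mulr_gt0// exprn_gt0.
  by rewrite invfM.
rewrite structure_functionE; apply: ler_wpM2l; first by rewrite invr_ge0 subr_ge0 ltW.
apply: (@Rintegral_ge_outer _ (incr_moment n l) _ _ (l * (10^-1 * K ^- 3) ^+ n) C
  (L_set alpha sigma D Ct nu u K)) => //.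
- exact: incr_moment_continuous.
- by move=> t _; apply: mean_ge0 => x _; exact: exprn_ge0.
- by rewrite mulr_ge0 ?exprn_ge0// ltW.
- by move=> t [tT _ _ _]; rewrite /= in_itv.
move=> t [/andP[t1 t2] [_ _ hsup] /andP[hw1 _] hw2].
have t0 : 0 <= t by rewrite (le_trans _ t1)// ltW.
have [V [uV dV pV]] := solution_regular t0.
have cV j := is_derive_continuous (dV j).
have V1 : (u t)^`() = V 1%N by rewrite uV -(derive1n_derivs 1 dV).
have V2 : (u t)^`(2) = V 2%N by rewrite uV (derive1n_derivs 2 dV).
have V1' : (u t)^`(1) = V 1%N by rewrite uV (derive1n_derivs 1 dV).
have [a ha] : exists a, forall x, a <= x <= a + l -> 10^-1 * K ^- 3 <= u t x - u t (x + l).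
  rewrite uV; apply: (@cliff_drop _ (V 0%N) (V 1%N) (V 2%N) K N) => //.
  - move=> x; apply: le_trans hsup; rewrite V1.
    have [M M0 VM] := periodic_bounded (cV 1%N) (pV 1%N).
    apply: sup_ubound; last by exists x.
    by exists M => _ [y _ <-]; exact: le_trans (ler_norm _) (VM y).
  - move=> x; have -> : K * N ^+ 2 = K * nu `^ (- 2 * beta alpha).
      congr (_ * _); rewrite -powR_mulrn ?powR_ge0// -powRrM; congr (_ `^ _); ring.
    by apply: le_trans hw2; rewrite /wnorm V2; exact: le_lpnorm_infty.
  - move: hw1; rewrite /wnorm V1' -/N; have [x1 [_ -> _]] := lpnorm_infty (cV 1%N).
    by move=> hx; exists x1.
  - by rewrite NE invrK.
apply: (@mean_incr_ge _ (u t) l _ a n) => //.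
- by rewrite (ltW l0).
- by rewrite uV; exact: cV.
- by rewrite uV; exact: pV.
Qed.

End bounds.
End Assembly.

Theorem corollary7p7 (R : realType) (alpha : R) (f : R -> R) (sigma D : R)
  (halpha : 1 < alpha < 2)
  (hf : admissible_flux f sigma)
  (Ct : R) (hCt0 : 0 < Ct)
  (hCt : forall (nu : R) (u0 : R -> R) (u : R -> R -> R),
     0 < nu <= 1 -> initial_condition D u0 -> solution alpha nu f u0 u ->
     forall t : R, 0 <= t ->
       (hsnorm (alpha / 2) (u t) ^+ 2 <= (Ct / nu)%:E)%E)
  (C K1 : R) (hC : 0 < C) (hK1 : 1 < K1)
  (hL : forall K : R, K1 <= K ->
     forall (nu : R) (u0 : R -> R) (u : R -> R -> R),
     0 < nu <= 1 -> initial_condition D u0 -> solution alpha nu f u0 u ->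
     (C%:E <= lebesgue_measure (L_set alpha sigma D Ct nu u K))%E) :
  exists c : R, 0 < c /\
    forall (nu : R) (u0 : R -> R) (u : R -> R -> R),
      0 < nu <= nu0 alpha K1 ->
      initial_condition D u0 -> solution alpha nu f u0 u ->
      forall l : R, C1 K1 * nu `^ beta alpha < l <= C2 K1 ->
        flatness sigma D Ct u l <= c * l^-1 /\
        l^-1 <= c * flatness sigma D Ct u l.
Proof.
(* the constant is chosen before u0, so the vacuous case D <= 0 comes first *)
have [D0|D0] := ltP 0 D; last first.
  exists 1; split => // nu u0 u _ hu0.
  by have [] := initial_lipschitz hu0; rewrite ltNge D0.
have K0 : 0 < K1 by lra.
pose gap := (T2 sigma D Ct - T1 D Ct)^-1.
have gap0 : 0 < gap by rewrite invr_gt0 subr_gt0 T1_lt_T2.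
pose k := 10^-1 * K1 ^- 3.
have k0 : 0 < k by rewrite mulr_gt0// invr_gt0 exprn_gt0.
pose a n := gap * (k ^+ n * C).
have a0 n : 0 < a n by rewrite !mulr_gt0// exprn_gt0.
pose b n := (2 * D) ^+ n.
have b0 n : 0 < b n by rewrite exprn_gt0// mulr_gt0.
exists (b 4%N / a 2%N ^+ 2 + b 2%N ^+ 2 / a 4%N); split.
  by rewrite addr_gt0// divr_gt0// exprn_gt0.
move=> nu u0 u /andP[nu_gt0 nule] hu0 su l hl.
have nu1 : nu <= 1.
  apply: (le_trans nule); rewrite /nu0.
  have e0 : 0 <= (beta alpha)^-1 by rewrite /beta invrK subr_ge0; case/andP: halpha => /ltW.
  have x0 : 0 <= 6^-1 * K1 ^- 2 by rewrite mulr_ge0// invr_ge0 exprn_ge0// ltW.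
  have x1 : 6^-1 * K1 ^- 2 <= 1.
    have : K1 ^- 2 <= 1 by rewrite invf_le1 ?exprn_gt0// exprn_ege1// ltW.
    lra.
  have := ge0_ler_powR e0 _ _ x1; rewrite !nnegrE => /(_ x0 ler01).
  by rewrite powR1.
have nu01 : 0 < nu <= 1 by rewrite nu_gt0.
have hL1 := hL K1 (lexx _) nu u0 u nu01 hu0 su.
have l0 : 0 < l.
  case/andP: hl => + _; apply: le_lt_trans; rewrite mulr_ge0 ?powR_ge0//.
  by rewrite mulr_ge0// invr_ge0 exprn_ge0// ltW.
have up n : structure_function sigma D Ct u n.+1%:R l <= b n.+1 * l.
  exact: (structure_function_le halpha nu_gt0 hCt0 hf hu0 su n (ltW l0)).
have low n : a n * l <= structure_function sigma D Ct u n%:R l.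
  have := structure_function_ge halpha nu_gt0 hCt0 hf hu0 su n hK1 hC nule hL1 hl.
  by apply: le_trans; rewrite /a -/gap -/k le_eqVlt; apply/orP; left; apply/eqP; ring.
exact: (ratio_bounds (a0 2%N) (b0 2%N) (a0 4%N) (b0 4%N) l0
  (up 1%N) (up 3%N) (low 2%N) (low 4%N)).
Qed.
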